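(* Let $n\ge 2$. There exists a unique family of simplices in $\mathbb{E}^n$ generating the group $\widetilde C_n$ (families being counted up to similarity). This family consists of the Coxeter simplices $\widetilde C_n$; that is, every simplex $P\subset\mathbb{E}^n$ generating $\widetilde C_n$ is itself a Coxeter simplex of type $\widetilde C_n$.
   Context: For a (compact, non-degenerate) simplex $P$ in Euclidean space $\mathbb{E}^n$, $G_P$ denotes the group generated by the reflections in the facets of $P$. A simplex is a Coxeter simplex if all its dihedral angles are of the form $\pi/k$, $k\ge2$ an integer; its Coxeter diagram has one node per facet, two nodes being joined by a $(k-2)$-fold edge if the facets form the angle $\pi/k$ (no edge if orthogonal). For $n\ge 2$, $\widetilde C_n$ is the Euclidean Coxeter simplex whose Coxeter diagram is a chain with $n+1$ nodes in which the two extreme edges are $2$-fold and all other edges are simple. $P$ is said to generate $\widetilde C_n$ if $G_P$ is discrete and a fundamental chamber of $G_P$ is a Coxeter simplex $\widetilde C_n$ (of any size). $P$ itself is not assumed to be a Coxeter simplex. If $f_0,\dots,f_n$ are the outward unit normals to the facets of $P$, the family of $P$ is the set of all simplices in $\mathbb{E}^n$ having the same set of vectors $\{\pm f_0,\dots,\pm f_n\}$ as facet normals; any two simplices of one family are similar. Families are classified up to similarity, so counting families means counting similarity classes of simplices. *)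

(* Defs.v *)
From HB Require Import structures.
From mathcomp Require Import all_boot all_order all_algebra all_fingroup.
From mathcomp Require Import all_classical all_reals all_analysis.

Set Implicit Arguments.
Unset Strict Implicit.
Unset Printing Implicit Defensive.

Import Order.TTheory GRing.Theory Num.Theory.
Import numFieldNormedType.Exports.

Local Open Scope classical_set_scope.
Local Open Scope ring_scope.

(* Euclidean space E^n is 'rV[R]_n with the dot product below. The library norm
   on 'rV[R]_n is the sup norm, hence a separate Euclidean norm; both norms
   induce the library topology of 'rV[R]_n. *)
Definition dot (R : realType) (n : nat) (x y : 'rV[R]_n) : R :=
  \sum_i x 0 i * y 0 i.

Definition enorm (R : realType) (n : nat) (x : 'rV[R]_n) : R :=
  Num.sqrt (dot x x).

Definition affinely_independent (R : realType) (n m : nat)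
    (v : 'I_m -> 'rV[R]_n) : Prop :=
  forall c : 'I_m -> R,
    \sum_i c i = 0 -> \sum_i c i *: v i = 0 -> forall i, c i = 0.

(* Vertices are labelled; the facet with label i is opposite to the vertex with
   label i. The simplex as a subset of E^n is [body]. *)
Record simplex (R : realType) (n : nat) := Simplex {
  vertex :> 'I_n.+1 -> 'rV[R]_n;
  vertex_indep : affinely_independent vertex }.

Definition body (R : realType) (n : nat) (P : simplex R n) : set 'rV[R]_n :=
  [set x | exists c : 'I_n.+1 -> R,
    [/\ forall i, 0 <= c i, \sum_i c i = 1 & x = \sum_i c i *: P i]].

Definition is_outward_normal (R : realType) (n : nat) (P : simplex R n)
    (i : 'I_n.+1) (f : 'rV[R]_n) : Prop :=
  [/\ enorm f = 1,
      forall j k, j != i -> k != i -> dot f (P j) = dot f (P k)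
    & forall j, j != i -> dot f (P i) < dot f (P j)].

Definition outward_normal (R : realType) (n : nat) (P : simplex R n)
    (i : 'I_n.+1) : 'rV[R]_n := xget 0 (is_outward_normal P i).

Definition hyperplane (R : realType) (n : nat) (u : 'rV[R]_n) (c : R) :
    set 'rV[R]_n := [set x | dot u x = c].

(* For a unit vector u, the orthogonal reflection in [hyperplane u c]. *)
Definition reflection (R : realType) (n : nat) (u : 'rV[R]_n) (c : R)
    (x : 'rV[R]_n) : 'rV[R]_n := x - (2 * (dot u x - c)) *: u.

(* The facet i spans the hyperplane orthogonal to its normal through any vertex
   P j with j != i; the value dot (outward_normal P i) (P j) is the same for all
   such j. *)
Definition facet_reflections (R : realType) (n : nat) (P : simplex R n) :
    set ('rV[R]_n -> 'rV[R]_n) :=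
  [set s | exists i j : 'I_n.+1, j != i /\
     s = reflection (outward_normal P i) (dot (outward_normal P i) (P j))].

Inductive generated_group (T : Type) (S : set (T -> T)) : set (T -> T) :=
| generated_gen s : S s -> generated_group S s
| generated_id : generated_group S id
| generated_comp g h :
    generated_group S g -> generated_group S h -> generated_group S (g \o h)
| generated_inv g h :
    generated_group S g -> cancel g h -> cancel h g -> generated_group S h.

Definition simplex_group (R : realType) (n : nat) (P : simplex R n) :
    set ('rV[R]_n -> 'rV[R]_n) := generated_group (facet_reflections P).

(* On groups of isometries of E^n the topology of pointwise convergence is the
   usual (compact-open) topology; a group is discrete when each of its elements
   is isolated in it. *)
Definition discrete_group (R : realType) (n : nat)
    (G : set ('rV[R]_n -> 'rV[R]_n)) : Prop :=
  isolated (G : set {ptws 'rV[R]_n -> 'rV[R]_n}) = G.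

Definition is_mirror (R : realType) (n : nat)
    (G : set ('rV[R]_n -> 'rV[R]_n)) (H : set 'rV[R]_n) : Prop :=
  exists u c, [/\ enorm u = 1, H = hyperplane u c & G (reflection u c)].

Definition mirror_complement (R : realType) (n : nat)
    (G : set ('rV[R]_n -> 'rV[R]_n)) : set 'rV[R]_n :=
  ~` \bigcup_(H in [set H | is_mirror G H]) H.

(* Chambers are closed here, so that they can be compared with compact
   simplices. *)
Definition fundamental_chamber (R : realType) (n : nat)
    (G : set ('rV[R]_n -> 'rV[R]_n)) (C : set 'rV[R]_n) : Prop :=
  exists2 x, mirror_complement G x &
    C = closure (connected_component (mirror_complement G) x).

(* The interior dihedral angle between the facets i and j. *)
Definition dihedral_angle (R : realType) (n : nat) (P : simplex R n)
    (i j : 'I_n.+1) : R :=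
  pi - acos (dot (outward_normal P i) (outward_normal P j)).

(* P is a Coxeter simplex in whose diagram the nodes i and j are joined by a
   (d i j)-fold edge, i.e. the corresponding angle is pi / (d i j + 2). *)
Definition coxeter_simplex_with_diagram (R : realType) (n : nat)
    (P : simplex R n) (d : 'I_n.+1 -> 'I_n.+1 -> nat) : Prop :=
  forall i j, i != j -> dihedral_angle P i j = pi / (d i j).+2%:R.

(* Edge multiplicities of the chain 0 - 1 - ... - n whose edges {0, 1} and
   {n - 1, n} are 2-fold and whose other edges are simple. *)
Definition C_tilde_edge (n : nat) (i j : 'I_n.+1) : nat :=
  (if (i.+1 == j) || (j.+1 == i) then
     if (minn i j == 0) || (maxn i j == n) then 2 else 1
   else 0)%N.

Definition coxeter_C_tilde (R : realType) (n : nat) (P : simplex R n) : Prop :=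
  exists s : {perm 'I_n.+1},
    coxeter_simplex_with_diagram P (fun i j => C_tilde_edge (s i) (s j)).

Definition generates_C_tilde (R : realType) (n : nat) (P : simplex R n) :
    Prop :=
  discrete_group (simplex_group P) /\
  exists2 Q : simplex R n, coxeter_C_tilde Q &
    fundamental_chamber (simplex_group P) (body Q).

Definition facet_normals (R : realType) (n : nat) (P : simplex R n) :
    set 'rV[R]_n :=
  [set u | exists i, u = outward_normal P i \/ u = - outward_normal P i].

Definition family (R : realType) (n : nat) (P : simplex R n) :
    set (simplex R n) := [set Q | facet_normals Q = facet_normals P].

Definition is_family (R : realType) (n : nat) (F : set (simplex R n)) : Prop :=
  exists P, F = family P.

Definition similarity (R : realType) (n : nat) (phi : 'rV[R]_n -> 'rV[R]_n) :
    Prop :=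
  exists2 r : R, 0 < r & forall x y, enorm (phi x - phi y) = r * enorm (x - y).

Definition similar_families (R : realType) (n : nat)
    (F F' : set (simplex R n)) : Prop :=
  exists2 phi, similarity phi &
    F' = [set Q | exists2 P, F P & body Q = phi @` body P].

(* The default value 0 of [outward_normal] is never used when n > 0. *)
Lemma outward_normalP (R : realType) (n : nat) (P : simplex R n)
    (i : 'I_n.+1) : (0 < n)%N -> is_outward_normal P i (outward_normal P i).
Proof.
move=> n0; apply: (@xgetPex _ 0).
pose A : 'M[R]_(1 + n) := \matrix_(k, l) (row_mx (1 : 'rV_1) (P k)) 0 l.
have Au : A \in unitmx.
  rewrite -row_free_unit; apply/inj_row_free => c cA0.
  have cA k : \sum_j c 0 j * A j k = 0 by have /rowP/(_ k) := cA0; rewrite !mxE.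
  apply/rowP => j; rewrite mxE.
  apply: (@vertex_indep _ _ P (fun j => c 0 j)).
  - have := cA (lshift n ord0); under eq_bigr do rewrite mxE row_mxEl mxE eqxx mulr1.
    by [].
  - apply/rowP => k; rewrite summxE mxE.
    have := cA (rshift 1 k); under eq_bigr do rewrite mxE row_mxEr.
    by under [in X in _ -> X]eq_bigr do rewrite mxE.
pose b := col i (invmx A).
pose a : 'rV[R]_n := \row_k b (rshift 1 k) 0.
pose b0 := b (lshift n 0) 0.
have Ab j : b0 + dot a (P j) = (j == i)%:R.
  have : (A *m b) j 0 = (j == i)%:R.
    transitivity ((A *m invmx A) j i); last by rewrite mulmxV // !mxE.
    by rewrite [LHS]mxE [RHS]mxE; apply: eq_bigr => k _; rewrite [b k 0]mxE.
  rewrite mxE big_split_ord /= big_ord1 [A _ _]mxE row_mxEl mxE eqxx mul1r.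
  move=> <-; congr (_ + _); apply: eq_bigr => k _.
  by rewrite [A _ _]mxE row_mxEr [a _ _]mxE mulrC.
have [j ji] : exists j, j != i.
  have [->|i0] := eqVneq i 0; last by exists 0; rewrite eq_sym.
  by exists ord_max; apply/eqP => /(congr1 val) /= nn; rewrite nn in n0.
have dotZ c (u v : 'rV[R]_n) : dot (c *: u) v = c * dot u v.
  by rewrite /dot mulr_sumr; apply: eq_bigr => k _; rewrite mxE mulrA.
have dotC (u v : 'rV[R]_n) : dot u v = dot v u.
  by apply: eq_bigr => k _; rewrite mulrC.
have daa : 0 < dot a a.
  have dge : 0 <= dot a a by apply: sumr_ge0 => k _; rewrite -expr2 sqr_ge0.
  rewrite lt_neqAle dge andbT eq_sym; apply/eqP => a0.
  have ak k : a 0 k = 0.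
    apply/eqP; have := psumr_eq0P _ a0; move=> /(_ _ k isT).
    by move=> H; rewrite -sqrf_eq0 expr2 H // => l _; rewrite -expr2 sqr_ge0.
  have a'0 l : dot a (P l) = 0.
    by apply: big1 => k _; rewrite ak mul0r.
  have := Ab i; have := Ab j; rewrite !a'0 !addr0 (negPf ji) eqxx => ->.
  by move/eqP; rewrite eq_sym oner_eq0.
have na : 0 < enorm a by rewrite sqrtr_gt0.
exists (- (enorm a)^-1 *: a); split.
- rewrite /enorm dotZ dotC dotZ mulrA mulrNN -expr2 sqrtrM ?sqr_ge0 //.
  by rewrite sqrtr_sqr -/(enorm a) ger0_norm ?invr_ge0 ?ltW // mulVf // gt_eqF.
- move=> k l ki li; rewrite !dotZ; congr (_ * _); apply: (addrI b0).
  by rewrite !Ab (negPf ki) (negPf li).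
- move=> k ki; rewrite !dotZ !mulNr ltrN2 ltr_pM2l ?invr_gt0 //.
  by rewrite -(ltrD2l b0) !Ab (negPf ki) eqxx ltr01.
Qed.

(* Main.v *)
(* In coordinates adapted to a Coxeter simplex of type C~_n the mirrors of its
   group are the hyperplanes x_i = k and x_i +- x_j = 2k (k an integer).

   Let P generate C~_n with chamber Q.  By discreteness the mirrors are locally
   finite, so the walls of Q are mirrors; folding along them moves every point
   off the standard hyperplanes into the interior of Q, which no mirror meets.
   Hence every mirror of G_P, in particular every facet of P, is standard.
   The hyperplanes x_i = k with k even, those with k odd and the remaining ones
   are three classes of mirrors; a parity invariant shows that the facets of P
   represent each of the first two, since the group contains such reflections.
   So among the n+1 facet normals at least two involve a single coordinate and
   the others at most two.  The normals satisfy a unique linear relation, and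
   its coefficients are positive; thus each of the n coordinates occurs in at
   least two normals, hence in exactly two by double counting.  Sharing a
   coordinate then makes the facets into a graph with degrees at most 2, which
   is connected by uniqueness of the relation: a path, and the Gram matrix of
   the normals is that of C~_n. *)
From HB Require Import structures.
Require Import Defs.
From mathcomp Require Import all_boot all_order all_algebra all_fingroup.
From mathcomp Require Import all_classical all_reals all_analysis.
From mathcomp Require Import ring lra zify.

Set Implicit Arguments.
Unset Strict Implicit.
Unset Printing Implicit Defensive.

Import Order.TTheory GRing.Theory Num.Theory.
Import numFieldNormedType.Exports.

Local Open Scope ring_scope.

(** * Simplices and their facet normals *)

(** Angles are exchanged for an integral Gram matrix: normals rescaled to the lengths 1 and sqrt 2
    behave like the roots e_k - e_(k+1), and the convention e_0 = e_(n+1) = 0 lets the two short end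
    roots fit the same formula. Recognising the type of [P] is then a question about its normals
    alone. From the chamber [body Q] two facts are extracted: no mirror of the group meets the open
    simplex, and the wall reflections of [Q] belong to the group. The second one lets the explicitly
    known group of [Q] act on the unknown mirrors. For the converse, elements of the group of a
    Coxeter simplex act as x_i -> +- x_t(i) + 2 m_i. The images of one test point separate them,
    which gives discreteness, and a fixed point inside the simplex forces the identity, so that no
    mirror enters it. For families, the positive relation forces the same sign change on all normals
    when passing from one member to another, so the type is constant on a family; two families of
    this type are exchanged by the orthogonal map between their frames. *)

Lemma dotC (R : realType) n (x y : 'rV[R]_n) : dot x y = dot y x.
Proof. by apply: eq_bigr => k _; rewrite mulrC. Qed.

Lemma dotDl (R : realType) n (x y z : 'rV[R]_n) :
  dot (x + y) z = dot x z + dot y z.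
Proof. by rewrite -big_split; apply: eq_bigr => k _; rewrite mxE mulrDl. Qed.

Lemma dotZl (R : realType) n c (x z : 'rV[R]_n) : dot (c *: x) z = c * dot x z.
Proof. by rewrite mulr_sumr; apply: eq_bigr => k _; rewrite mxE mulrA. Qed.

Lemma dotNl (R : realType) n (x z : 'rV[R]_n) : dot (- x) z = - dot x z.
Proof. by rewrite -scaleN1r dotZl mulN1r. Qed.

Lemma dotBl (R : realType) n (x y z : 'rV[R]_n) :
  dot (x - y) z = dot x z - dot y z.
Proof. by rewrite dotDl dotNl. Qed.

Lemma dot0l (R : realType) n (z : 'rV[R]_n) : dot 0 z = 0.
Proof. by rewrite -[0](scale0r (0 : 'rV[R]_n)) dotZl mul0r. Qed.

Lemma dot_suml (R : realType) n I (r : seq I) (F : I -> 'rV[R]_n) z :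
  dot (\sum_(i <- r) F i) z = \sum_(i <- r) dot (F i) z.
Proof.
by elim/big_rec2: _ => [|i x y _ <-]; rewrite ?dot0l // dotDl.
Qed.

Lemma dotDr (R : realType) n (x y z : 'rV[R]_n) :
  dot x (y + z) = dot x y + dot x z.
Proof. by rewrite dotC dotDl !(dotC x). Qed.

Lemma dotZr (R : realType) n c (x z : 'rV[R]_n) : dot x (c *: z) = c * dot x z.
Proof. by rewrite dotC dotZl (dotC x). Qed.

Lemma dotNr (R : realType) n (x z : 'rV[R]_n) : dot x (- z) = - dot x z.
Proof. by rewrite dotC dotNl (dotC x). Qed.

Lemma dotBr (R : realType) n (x y z : 'rV[R]_n) :
  dot x (y - z) = dot x y - dot x z.
Proof. by rewrite dotDr dotNr. Qed.

Lemma dot0r (R : realType) n (z : 'rV[R]_n) : dot z 0 = 0.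
Proof. by rewrite dotC dot0l. Qed.

Lemma dot_sumr (R : realType) n I (r : seq I) (F : I -> 'rV[R]_n) z :
  dot z (\sum_(i <- r) F i) = \sum_(i <- r) dot z (F i).
Proof. by rewrite dotC dot_suml; apply: eq_bigr => i _; rewrite dotC. Qed.

Definition dotE := (dotDl, dotDr, dotBl, dotBr, dotZl, dotZr, dotNl, dotNr,
  dot0l, dot0r).

Lemma dot_ge0 (R : realType) n (x : 'rV[R]_n) : 0 <= dot x x.
Proof. by apply: sumr_ge0 => i _; rewrite -expr2 sqr_ge0. Qed.

Lemma dot_eq0 (R : realType) n (x : 'rV[R]_n) : dot x x = 0 -> x = 0.
Proof.
move=> x0; apply/rowP => k; rewrite mxE; apply/eqP.
rewrite -sqrf_eq0 expr2; apply/eqP.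
by apply: (psumr_eq0P _ x0) => // l _; rewrite -expr2 sqr_ge0.
Qed.

Lemma dot_all_eq0 (R : realType) n (x : 'rV[R]_n) :
  (forall y, dot x y = 0) -> x = 0.
Proof. by move=> x0; apply: dot_eq0. Qed.

Lemma enorm1P (R : realType) n (x : 'rV[R]_n) : enorm x = 1 <-> dot x x = 1.
Proof.
split => [|x1]; last by rewrite /enorm x1 sqrtr1.
by move=> x1; rewrite -(sqr_sqrtr (dot_ge0 x)) -/(enorm x) x1 expr1n.
Qed.

Lemma unit_dot1_eq (R : realType) n (x y : 'rV[R]_n) :
  dot x x = 1 -> dot y y = 1 -> dot x y = 1 -> x = y.
Proof.
move=> xx yy xy; apply/eqP; rewrite -subr_eq0; apply/eqP/dot_eq0.
by rewrite !dotE xx yy (dotC y) xy; ring.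
Qed.

Lemma unit_parallel (R : realType) n (x y : 'rV[R]_n) :
  dot x x = 1 -> dot y y = 1 -> dot x y ^+ 2 = 1 -> x = y \/ x = - y.
Proof.
move=> xx yy /eqP; rewrite sqrf_eq1 => /orP[] /eqP xy.
  by left; apply: unit_dot1_eq.
by right; apply: unit_dot1_eq; rewrite ?dotE ?opprK // xy opprK.
Qed.

(** Affine independence says that the square matrix with rows (1, P k) is invertible; the weights
    are then read off from the row (1, y). *)
Lemma barycentric_exists (R : realType) n (P : simplex R n) y :
  exists c : 'I_n.+1 -> R, \sum_i c i = 1 /\ y = \sum_i c i *: P i.
Proof.
pose A : 'M[R]_(1 + n) := \matrix_(k, l) (row_mx (1 : 'rV_1) (P k)) 0 l.
have Au : A \in unitmx.
  rewrite -row_free_unit; apply/inj_row_free => c cA0.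
  have cA k : \sum_j c 0 j * A j k = 0 by have /rowP/(_ k) := cA0; rewrite !mxE.
  apply/rowP => j; rewrite mxE.
  apply: (@vertex_indep _ _ P (fun j => c 0 j)).
  - have := cA (lshift n ord0).
    by under eq_bigr do rewrite mxE row_mxEl mxE eqxx mulr1.
  - apply/rowP => k; rewrite summxE mxE.
    have := cA (rshift 1 k); under eq_bigr do rewrite mxE row_mxEr.
    by under [in X in _ -> X]eq_bigr do rewrite mxE.
pose c := row_mx (1 : 'rV_1) y *m invmx A.
have cA : c *m A = row_mx 1 y by rewrite mulmxKV.
exists (fun i => c 0 i); split.
  have := congr1 (fun M : 'rV_(1 + n) => M 0 (lshift n ord0)) cA.
  rewrite /= row_mxEl mxE [X in _ = X]mxE eqxx => E; apply: etrans E.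
  by apply: eq_bigr => j _; rewrite [A _ _]mxE row_mxEl [X in _ * X]mxE eqxx mulr1.
apply/rowP => k; rewrite summxE.
have := congr1 (fun M : 'rV_(1 + n) => M 0 (rshift 1 k)) cA.
rewrite /= row_mxEr mxE => <-; apply: eq_bigr => j _.
by rewrite [A _ _]mxE row_mxEr [RHS]mxE.
Qed.

Lemma other_index n (i : 'I_n.+1) : (0 < n)%N -> exists j : 'I_n.+1, j != i.
Proof.
move=> n0; have [->|i0] := eqVneq i 0; last by exists 0; rewrite eq_sym.
by exists ord_max; apply/eqP => /(congr1 val) /= nn; rewrite nn in n0.
Qed.

(* Any vertex of the facet [i] gives the same value; see [offsetP]. *)
Definition offset (R : realType) n (P : simplex R n) (i : 'I_n.+1) : R :=
  dot (outward_normal P i) (P (xget i [set j | j != i])).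

(** The altitude of [P] over its facet [i]. Its inverse is proportional to the volume of that facet,
    so [normal_relation] below is Minkowski's relation for a simplex. *)
Definition height (R : realType) n (P : simplex R n) (i : 'I_n.+1) : R :=
  offset P i - dot (outward_normal P i) (P i).

Lemma offsetP (R : realType) n (P : simplex R n) (i j : 'I_n.+1) :
  (0 < n)%N -> j != i -> dot (outward_normal P i) (P j) = offset P i.
Proof.
move=> n0 ji; have [_ + _] := outward_normalP P i n0; apply => //.
by have := xgetPex i (other_index i n0).
Qed.

Lemma height_gt0 (R : realType) n (P : simplex R n) i :
  (0 < n)%N -> 0 < height P i.
Proof.
move=> n0; have [j ji] := other_index i n0.
have [_ _ /(_ j ji)] := outward_normalP P i n0.
by rewrite (offsetP P n0 ji) subr_gt0.
Qed.

Lemma normal_unit (R : realType) n (P : simplex R n) i :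
  (0 < n)%N -> dot (outward_normal P i) (outward_normal P i) = 1.
Proof. by move=> n0; have [/enorm1P] := outward_normalP P i n0. Qed.

Lemma dot_normal_vertex (R : realType) n (P : simplex R n) (i j : 'I_n.+1) :
  (0 < n)%N ->
  dot (outward_normal P i) (P j) = offset P i - (i == j)%:R * height P i.
Proof.
move=> n0; case: eqVneq => [->|ij]; first by rewrite /height mul1r subKr.
by rewrite mul0r subr0 offsetP // eq_sym.
Qed.

(** A barycentric coordinate is the distance to the opposite facet measured in altitudes; this is
    the passage between vertices and normals used throughout. *)
Lemma barycentric_normal (R : realType) n (P : simplex R n) (c : 'I_n.+1 -> R) i :
  (0 < n)%N -> \sum_i c i = 1 ->
  offset P i - dot (outward_normal P i) (\sum_i c i *: P i) = c i * height P i.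
Proof.
move=> n0 c1; rewrite dot_sumr.
under eq_bigr do rewrite dotZr dot_normal_vertex // mulrBr.
rewrite sumrB -mulr_suml c1 mul1r opprB addrCA subrr addr0.
rewrite (bigD1 i) //= eqxx mul1r big1 ?addr0 // => j ji.
by rewrite eq_sym (negPf ji) mul0r mulr0.
Qed.

Lemma bodyP (R : realType) n (P : simplex R n) y : (0 < n)%N ->
  body P y <-> forall i, dot (outward_normal P i) y <= offset P i.
Proof.
move=> n0; split.
  move=> [c [c0 c1 ->]] i; rewrite -subr_ge0 barycentric_normal //.
  by rewrite mulr_ge0 // ltW // height_gt0.
have [c [c1 ->]] := barycentric_exists P y => H; exists c; split => // i.
have := H i; rewrite -subr_ge0 barycentric_normal //.
by rewrite pmulr_lge0 // height_gt0.
Qed.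

(** [outward_normal] is picked by choice, so computing it requires uniqueness. Two candidates, each
    scaled by the altitude of the other, differ by a vector having the same product with every
    vertex, hence with every point, so the difference is 0. *)
Lemma is_outward_normal_uniq (R : realType) n (P : simplex R n) i f :
  (0 < n)%N -> is_outward_normal P i f -> outward_normal P i = f.
Proof.
move=> n0 [/enorm1P f1 fE fi].
have [j ji] := other_index i n0.
set g := outward_normal P i.
pose a := dot f (P j) - dot f (P i).
have a0 : 0 < a by rewrite subr_gt0 fi.
have fP k : dot f (P k) = dot f (P j) - (k == i)%:R * a.
  case: eqVneq => [->|ki]; first by rewrite mul1r subKr.
  by rewrite mul0r subr0; apply: fE.
have h0 := height_gt0 P i n0.
have gh : dot g (P i) = dot g (P j) - height P i.
  by rewrite !dot_normal_vertex // eqxx eq_sym (negPf ji) mul0r subr0 mul1r.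
have key : height P i *: f = a *: g.
  apply/eqP; rewrite -subr_eq0; apply/eqP/dot_all_eq0 => y.
  have K z : dot (height P i *: f - a *: g) z
             = dot (height P i *: f - a *: g) (P j).
    have [c [c1 ->]] := barycentric_exists P z.
    rewrite dot_sumr -[RHS]mul1r -c1 mulr_suml; apply: eq_bigr => k _.
    rewrite dotZr; congr (_ * _).
    rewrite !dotE (fP k) !dot_normal_vertex // (eq_sym i j).
    rewrite (negPf ji) (eq_sym i) -/g.
    by rewrite /= mul0r subr0; ring.
  by rewrite K -(K 0) dot0r.
have fg : f = (a / height P i) *: g.
  rewrite mulrC -scalerA -key scalerA mulVf ?scale1r //.
  by rewrite gt_eqF.
have c0 : 0 < a / height P i by rewrite divr_gt0.
have : (a / height P i) ^+ 2 = 1.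
  move: f1; rewrite fg !dotE normal_unit // mulr1 => <-.
  by rewrite expr2.
move/eqP; rewrite sqrf_eq1 => /orP[] /eqP E; last first.
  by move: c0; rewrite E ltr0N1.
by rewrite fg E scale1r.
Qed.

(** The barycentric coordinates of any point sum to 1; expressed through the normals this is an
    affine identity in the point, and the relation is its linear part. *)
Lemma normal_relation (R : realType) n (P : simplex R n) : (0 < n)%N ->
  \sum_i (height P i)^-1 *: outward_normal P i = 0.
Proof.
move=> n0; apply/dot_all_eq0 => y; rewrite dot_suml.
have K z : \sum_i dot ((height P i)^-1 *: outward_normal P i) z =
           \sum_i offset P i / height P i - 1.
  have [c [c1 ->]] := barycentric_exists P z.
  rewrite -c1 -sumrB; apply: eq_bigr => i _; rewrite dotZl.
  have h0 : height P i != 0 by rewrite gt_eqF // height_gt0.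
  have /(congr1 (fun t => t / height P i)) := barycentric_normal P i n0 c1.
  by rewrite mulfK // => <-; field.
by rewrite K -(K 0) big1 // => i _; rewrite dot0r.
Qed.

(** Pairing a relation with the vertex [P j] leaves a single correction term, so [nu j * height P j]
    is the same number for all [j]. *)
Lemma normal_relation_uniq (R : realType) n (P : simplex R n)
    (nu : 'I_n.+1 -> R) : (0 < n)%N ->
  \sum_i nu i *: outward_normal P i = 0 ->
  exists K, forall i, nu i = K / height P i.
Proof.
move=> n0 E; exists (\sum_i nu i * offset P i) => j.
have h0 : height P j != 0 by rewrite gt_eqF // height_gt0.
have : dot (\sum_i nu i *: outward_normal P i) (P j) = 0 by rewrite E dot0l.
rewrite dot_suml.
under eq_bigr do rewrite dotZl dot_normal_vertex // mulrBr.
rewrite sumrB => /eqP; rewrite subr_eq0 => /eqP ->.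
rewrite (bigD1 j) //= eqxx mul1r big1 ?addr0 ?mulfK // => i ij.
by rewrite (negPf ij) mul0r mulr0.
Qed.

Lemma normal_span (R : realType) n (P : simplex R n) w : (0 < n)%N ->
  (forall i, dot (outward_normal P i) w = 0) -> w = 0.
Proof.
move=> n0 H; have [c [c1 cw]] := barycentric_exists P w.
have [d [d1 d0]] := barycentric_exists P 0.
rewrite [LHS]cw [RHS]d0; apply: eq_bigr => i _; congr (_ *: _).
have h0 : height P i != 0 by rewrite gt_eqF // height_gt0.
apply: (mulIf h0); rewrite -(barycentric_normal P i n0 c1) -cw H.
by rewrite -(barycentric_normal P i n0 d1) -d0 dot0r.
Qed.

Lemma barycentric_uniq (R : realType) n (P : simplex R n) (c d : 'I_n.+1 -> R) :
  \sum_i c i = \sum_i d i -> \sum_i c i *: P i = \sum_i d i *: P i -> c =1 d.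
Proof.
move=> cd E i; apply/eqP; rewrite -subr_eq0; apply/eqP.
apply: (@vertex_indep _ _ P (fun i => c i - d i)).
  by rewrite sumrB cd subrr.
by under eq_bigr do rewrite scalerBl; rewrite sumrB E subrr.
Qed.

(** * Chains of roots and adapted frames *)

Lemma dot_unit_bound (R : realType) n (x y : 'rV[R]_n) :
  dot x x = 1 -> dot y y = 1 -> -1 <= dot x y <= 1.
Proof.
move=> xx yy; have := dot_ge0 (x + y); have := dot_ge0 (x - y).
by rewrite !dotE xx yy (dotC y x); lra.
Qed.

Lemma pi_div_itv (R : realType) d : 0 <= (pi : R) / d.+2%:R <= pi.
Proof.
have pi0 : (0 : R) <= pi by exact: pi_ge0.
rewrite divr_ge0 //= ler_pdivrMr // -{1}[pi]mulr1 ler_wpM2l //.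
by rewrite ler1n.
Qed.

Lemma dihedral_angleP (R : realType) n (P : simplex R n) i j d : (0 < n)%N ->
  dihedral_angle P i j = pi / d.+2%:R <->
  dot (outward_normal P i) (outward_normal P j) = - cos (pi / d.+2%:R).
Proof.
move=> n0; rewrite /dihedral_angle.
set x := dot _ _; have x1 : -1 <= x <= 1 by apply: dot_unit_bound; rewrite normal_unit.
have dpi : pi / d.+2%:R \in `[(0 : R), pi] by rewrite in_itv /= pi_div_itv.
split => [<-|->].
  by rewrite cosB cospi sinpi mul0r addr0 mulN1r opprK acosK.
by rewrite acosN ?cosK // ?subKr // cos_geN1 cos_le1.
Qed.

Lemma cos_pi4 (R : realType) : cos (pi / 4 : R) = (Num.sqrt 2)^-1.
Proof.
have c0 : 0 < cos (pi / 4 : R).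
  by apply: cos_gt0_pihalf; have := pi_gt0 R; lra.
have E : cos (pi / 4 : R) ^+ 2 = 2^-1.
  have := cos_pihalf R; rewrite (_ : pi / 2 = pi / 4 + pi / 4); last by field.
  rewrite cosD; have := cos2Dsin2 (pi / 4 : R); rewrite !expr2; lra.
apply: (@pexpIrn _ 2) => //; rewrite ?nnegrE ?ltW // ?invr_gt0 ?sqrtr_gt0 //.
by rewrite E exprVn sqr_sqrtr.
Qed.

Lemma cos_pi3 (R : realType) : cos (pi / 3 : R) = 2^-1.
Proof.
set c := cos _; have c0 : 0 < c.
  by apply: cos_gt0_pihalf; have := pi_gt0 R; lra.
(* The triple angle formula turns cos pi = -1 into 4c^3 - 3c + 1 = 0, which factors in this way. *)
have E : (c + 1) * (2 * c - 1) ^+ 2 = 0.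
  have := cospi R; rewrite (_ : pi = pi / 3 + (pi / 3 + pi / 3)); last by field.
  rewrite !cosD !sinD -/c; set s := sin _ => H.
  have S : s ^+ 2 = 1 - c ^+ 2 by have := cos2Dsin2 (pi / 3 : R); rewrite -/c -/s => <-; ring.
  have : c * c ^+ 2 - 3 * c * s ^+ 2 = -1 by rewrite -H; ring.
  rewrite S => H'; transitivity (c * c ^+ 2 - 3 * c * (1 - c ^+ 2) + 1).
    by ring.
  by rewrite H' addNr.
move/eqP: E; rewrite mulf_eq0 expf_eq0 /= => /orP[] /eqP; lra.
Qed.

(** Lengths of the roots in the chain below: the two end roots reduce to single unit vectors up to
    sign. *)
Definition root_len (R : realType) (n k : nat) : R :=
  if (k == 0%N) || (k == n) then 1 else Num.sqrt 2.

(* Gram matrix of the chain of roots [e k - e k.+1], [0 <= k <= n], where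
   [e 1 .. e n] is orthonormal and [e 0 = e n.+1 = 0]. *)
Definition chain_gram (R : realType) (n k l : nat) : R :=
  (k == l)%:R * ((k != 0%N)%:R + (k != n)%:R)
  - (k.+1 == l)%:R - (l.+1 == k)%:R.

Lemma root_len_gt0 (R : realType) n k : 0 < root_len R n k.
Proof. by rewrite /root_len; case: ifP => _; rewrite ?ltr01 ?sqrtr_gt0. Qed.

Lemma root_len_neq0 (R : realType) n k : root_len R n k != 0.
Proof. by rewrite gt_eqF // root_len_gt0. Qed.

Lemma root_len_sqr (R : realType) n k : (2 <= n)%N -> (k <= n)%N ->
  root_len R n k ^+ 2 = chain_gram R n k k.
Proof.
move=> n2 kn; rewrite /root_len /chain_gram eqxx.
have -> : (k.+1 == k) = false by lia.
have [->|k0] /= := eqVneq k 0%N.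
  have -> : (0%N == n) = false by lia.
  by rewrite /= expr1n; ring.
have [_|_] /= := eqVneq k n; first by rewrite expr1n; ring.
by rewrite sqr_sqrtr //; ring.
Qed.

(** On a 2-fold edge the lengths are 1 and sqrt 2 and the cosine is 1 / sqrt 2; on a simple edge
    they are sqrt 2, sqrt 2 and 1 / 2. Both products equal 1. For [2 <= n] the two short roots are
    never neighbours. *)
Lemma cos_edge (R : realType) n (k l : 'I_n.+1) : (2 <= n)%N -> k != l ->
  root_len R n k * root_len R n l * cos (pi / (C_tilde_edge k l).+2%:R)
  = - chain_gram R n k l.
Proof.
move=> n2; wlog kl : k l / (k < l)%N.
  move=> H kl; have [|kl'|E] := ltngtP k l; first by move=> ?; apply: H.
    have := H l k kl'; rewrite eq_sym => /(_ kl).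
    rewrite (mulrC (root_len R n l)) /C_tilde_edge orbC minnC maxnC => ->.
    rewrite /chain_gram (eq_sym (l : nat) k).
    by rewrite (_ : (k == l :> nat) = false) ?mul0r; [ring|lia].
  by move: kl; rewrite (val_inj E) eqxx.
move=> _; rewrite /C_tilde_edge /chain_gram.
have -> : (k == l :> nat) = false by lia.
have -> : (l.+1 == k) = false by lia.
rewrite orbF mul0r; have ln := ltn_ord l.
have [kl1|kl1] := eqVneq k.+1 (l : nat); last first.
  by rewrite cos_pihalf /=; ring.
have -> : minn k l = k by lia.
have -> : maxn k l = l by lia.
have s0 : Num.sqrt 2 != 0 :> R by rewrite gt_eqF // sqrtr_gt0.
rewrite /root_len.
have -> : (k == n :> nat) = false by lia.
have -> : (l == 0 :> nat) = false by lia.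
rewrite orbF /=.
have [k0|k0] /= := eqVneq (k : nat) 0%N.
  have -> : (l == n :> nat) = false by lia.
  by rewrite cos_pi4 mul1r mulfV //; ring.
case: ifP => _; first by rewrite cos_pi4 mulr1 mulfV //; ring.
by rewrite cos_pi3 -expr2 sqr_sqrtr // mulfV //; ring.
Qed.

Lemma coxeter_C_tildeP (R : realType) n (P : simplex R n) : (2 <= n)%N ->
  coxeter_C_tilde P <-> exists s : {perm 'I_n.+1}, forall i j,
   dot (root_len R n (s i) *: outward_normal P i)
       (root_len R n (s j) *: outward_normal P j) = chain_gram R n (s i) (s j).
Proof.
move=> n2; have n0 : (0 < n)%N by lia.
split=> -[s H]; exists s => i j; last first.
  move=> ij; have sij : s i != s j by rewrite (inj_eq perm_inj).
  apply/(dihedral_angleP P i j _ n0).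
  have := H i j; rewrite dotZl dotZr mulrA -[RHS]opprK -cos_edge // -mulrN.
  by apply: mulfI; rewrite mulf_neq0 // root_len_neq0.
have [->|ij] := eqVneq i j.
  rewrite dotZl dotZr mulrA normal_unit // mulr1 -expr2 root_len_sqr //.
  by rewrite -ltnS.
have sij : s i != s j by rewrite (inj_eq perm_inj).
have /(dihedral_angleP P i j _ n0) E := H i j ij.
by rewrite dotZl dotZr mulrA E mulrN cos_edge // opprK.
Qed.

Definition frame (R : realType) (n : nat) (e : nat -> 'rV[R]_n) : Prop :=
  forall i j, (i <= n.+1)%N -> (j <= n.+1)%N ->
    dot (e i) (e j) = ((i == j) && (0 < i <= n)%N)%:R.

Definition chain_root (R : realType) n (e : nat -> 'rV[R]_n) k := e k - e k.+1.

Lemma frame_gram (R : realType) n (e : nat -> 'rV[R]_n) k l :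
  frame e -> (k <= n)%N -> (l <= n)%N ->
  dot (chain_root e k) (chain_root e l) = chain_gram R n k l.
Proof.
move=> fe kn ln; rewrite /chain_root !dotE !fe; try lia.
rewrite /chain_gram eqSS.
have [->|kl] := eqVneq k l.
  have -> : (l == l.+1) = false by lia.
  have -> : (l.+1 == l) = false by lia.
  have -> : (0 < l <= n)%N = (l != 0%N) by lia.
  have -> : (0 < l.+1 <= n)%N = (l != n) by lia.
  by rewrite /=; ring.
have -> : (k == l.+1) && (0 < k <= n)%N = (l.+1 == k) by lia.
have -> : (k.+1 == l) && (0 < k.+1 <= n)%N = (k.+1 == l) by lia.
by rewrite /=; ring.
Qed.

(** The roots telescope: a partial row sum is the product of e a - e a.+1 with - e j. *)
Lemma chain_gram_sum (R : realType) n a j : (0 < n)%N -> (a <= n)%N -> (j <= n.+1)%N ->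
  \sum_(b < j) chain_gram R n a b =
  ((j == a.+1) && (j <= n)%N)%:R - ((j == a) && (0 < j)%N)%:R.
Proof.
move=> n0 an; elim: j => [|j IH] jn; first by rewrite big_ord0 andbF subrr.
rewrite big_ord_recr /= IH; last by lia.
rewrite /chain_gram eqSS.
have [->|aj] := eqVneq j a.
  have -> : (a == a.+1) = false by lia.
  have -> : (a.+1 == a) = false by lia.
  rewrite an /=.
  have -> : (0 < a)%N = (a != 0%N) by lia.
  have -> : (a < n)%N = (a != n) by lia.
  by rewrite /=; ring.
rewrite (eq_sym a.+1) andbT /=.
have -> : (j == a.+1) && (j <= n)%N = (j == a.+1) by lia.
by rewrite /=; ring.
Qed.

(** Telescoping from e 0 = 0 recovers the frame from the chain by partial sums; the full sum has
    norm 0, which is the condition e n.+1 = 0. *)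
Lemma frame_of_gram (R : realType) n (g : nat -> 'rV[R]_n) : (0 < n)%N ->
  (forall k l, (k <= n)%N -> (l <= n)%N ->
     dot (g k) (g l) = chain_gram R n k l) ->
  frame (fun j => - \sum_(b < j) g b).
Proof.
move=> n0 gg i j; rewrite dotNl dotNr opprK dot_suml.
elim: i => [|i IH] jn ijn; first by rewrite big_ord0 andbF.
rewrite big_ord_recr /= IH; try lia.
rewrite dot_sumr.
have -> : \sum_(b < j) dot (g i) (g b) = \sum_(b < j) chain_gram R n i b.
  by apply: eq_bigr => b _; rewrite gg //; have := ltn_ord b; lia.
rewrite chain_gram_sum //.
have -> : (j == i.+1) && (j <= n)%N = (i.+1 == j) && (0 < i.+1 <= n)%N by lia.
have -> : (i == j) && (0 < i <= n)%N = (j == i) && (0 < j)%N by lia.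
by rewrite /=; ring.
Qed.

(* [e], [v], [r] are coordinates in which the facet [s^-1 k] of [P] is
   [x_k = x_(k+1)], where [x_0 = 0] and [x_(n+1) = 1]. *)
Definition adapted_frame (R : realType) n (P : simplex R n)
    (s : {perm 'I_n.+1}) (e : nat -> 'rV[R]_n) (v : 'rV[R]_n) (r : R) : Prop :=
  [/\ frame e, 0 < r,
   forall i, outward_normal P i = (root_len R n (s i))^-1 *: chain_root e (s i) &
   forall i, offset P i =
     (root_len R n (s i))^-1 * (dot (chain_root e (s i)) v + (s i == n :> nat)%:R * r)].

Lemma adapted_frame_exists (R : realType) n (P : simplex R n) : (2 <= n)%N ->
  coxeter_C_tilde P -> exists s e v r, adapted_frame P s e v r.
Proof.
move=> n2 /(coxeter_C_tildeP P n2) [s H]; have n0 : (0 < n)%N by lia.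
pose g k := root_len R n k *: outward_normal P ((s^-1)%g (inord k)).
pose e j := - \sum_(b < j) g b.
have sg (k : nat) : (k <= n)%N -> s ((s^-1)%g (inord k)) = k :> nat.
  by move=> kn; rewrite permKV inordK.
have fe : frame e.
  apply: frame_of_gram => // k l kn ln.
  by rewrite /g -{1}(sg k kn) -{1}(sg l ln) H !sg.
have re k : chain_root e k = g k.
  by rewrite /chain_root /e big_ord_recr /= opprK addKr.
have N i : outward_normal P i = (root_len R n (s i))^-1 *: chain_root e (s i).
  rewrite re /g inord_val permK scalerA mulVf ?scale1r //.
  exact: root_len_neq0.
(* The origin is the vertex opposite to the facet x_n = 1, through which all other facets pass; the
   unit of length is the altitude from it. *)
exists s, e, (P ((s^-1)%g ord_max)), (height P ((s^-1)%g ord_max)).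
split => //; first exact: height_gt0.
move=> i; rewrite mulrDr -dotZl -N dot_normal_vertex //.
have -> : (i == (s^-1)%g ord_max) = (s i == n :> nat).
  by rewrite -(inj_eq (@perm_inj _ s)) permKV.
case: eqVneq => [E|_]; last by rewrite !mul0r mulr0 subr0 addr0.
rewrite /root_len E eqxx orbT invr1 !mul1r.
have -> : (s^-1)%g ord_max = i by apply: (@perm_inj _ s); rewrite permKV; apply: val_inj.
by rewrite subrK.
Qed.

Lemma adapted_coxeter (R : realType) n (P : simplex R n) (s : {perm 'I_n.+1}) e :
  (2 <= n)%N -> frame e ->
  (forall i, outward_normal P i = (root_len R n (s i))^-1 *: chain_root e (s i)) ->
  coxeter_C_tilde P.
Proof.
move=> n2 fe N; apply/coxeter_C_tildeP => //; exists s => i j.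
rewrite !N !scalerA !mulfV ?root_len_neq0 // !scale1r frame_gram //.
  by rewrite -ltnS.
by rewrite -ltnS.
Qed.

(** * Counting coordinates in the facet normals *)

Lemma uniq_leq_card (T : finType) (A : {set T}) (l : seq T) :
  uniq l -> {subset l <= A} -> (size l <= #|A|)%N.
Proof. by move=> ul lA; rewrite cardE; apply: uniq_leq_size => // y /lA; rewrite mem_enum. Qed.

(** Grow a path from [x0]: connectivity gives an edge leaving it, and since the earlier vertices of
    the path are saturated, the edge starts at the last one. The same saturation excludes chords,
    and the degree bound at [x1] places it at the far end. *)
Lemma path_enumeration (T : finType) (adj : rel T) (x0 x1 : T) (n : nat) :
  #|T| = n.+1 -> symmetric adj -> irreflexive adj -> x0 != x1 ->
  (forall f, (#|[set g | adj f g]| <= (if (f == x0) || (f == x1) then 1 else 2))%N) ->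
  (forall S : {set T}, x0 \in S -> S != [set: T] ->
     exists f g, [/\ f \in S, g \notin S & adj f g]) ->
  exists p : seq T, [/\ uniq p, size p = n.+1, nth x0 p 0 = x0, nth x0 p n = x1 &
    forall i j, (i <= n)%N -> (j <= n)%N ->
      adj (nth x0 p i) (nth x0 p j) = (i.+1 == j) || (j.+1 == i)].
Proof.
move=> cT sadj irr x01 deg conn.
have no3 f g h k : adj f g -> adj f h -> adj f k -> uniq [:: g; h; k] -> False.
  move=> fg fh fk u.
  have := @uniq_leq_card _ [set g | adj f g] _ u.
  have H : {subset [:: g; h; k] <= [set g | adj f g]}.
    by move=> y; rewrite !inE => /or3P[] /eqP ->.
  by move=> /(_ H) /=; have := deg f; case: ifP; lia.
have no2 f g h : (f == x0) || (f == x1) -> adj f g -> adj f h -> g != h -> False.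
  move=> fx fg fh gh.
  have := @uniq_leq_card _ [set g | adj f g] [:: g; h].
  rewrite /= inE gh => /(_ isT).
  have H : {subset [:: g; h] <= [set g | adj f g]}.
    by move=> y; rewrite !inE => /orP[] /eqP ->.
  by move=> /(_ H); have := deg f; rewrite fx; lia.
(* An inner vertex of a path already has its two neighbours. *)
have inner p k i g : uniq p -> size p = k.+1 -> nth x0 p 0 = x0 ->
    (forall i, (i < k)%N -> adj (nth x0 p i) (nth x0 p i.+1)) ->
    (i < k)%N -> adj (nth x0 p i) g -> g != nth x0 p i.+1 ->
    (0 < i)%N && (g == nth x0 p i.-1).
  move=> up sp p0 pa ik ig gi.
  have [i0|i0] := posnP i.
    exfalso; apply: (no2 (nth x0 p i) g (nth x0 p i.+1)) => //.
      by rewrite i0 p0 eqxx.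
    exact: pa.
  apply: contraT => gi'; exfalso.
  apply: (no3 (nth x0 p i) g (nth x0 p i.+1) (nth x0 p i.-1)) => //.
  - exact: pa.
  - rewrite sadj -{2}(prednK i0); apply: pa; lia.
  - rewrite /= !inE negb_or gi gi' /= andbT nth_uniq //; lia.
have [p [up sp p0 pa]] : exists p : seq T, [/\ uniq p, size p = n.+1,
    nth x0 p 0 = x0 & forall i, (i < n)%N -> adj (nth x0 p i) (nth x0 p i.+1)].
  suff H k : (k <= n)%N -> exists p : seq T, [/\ uniq p, size p = k.+1,
      nth x0 p 0 = x0 & forall i, (i < k)%N -> adj (nth x0 p i) (nth x0 p i.+1)].
    exact: H.
  elim: k => [|k IH] kn; first by exists [:: x0].
  have [p [up sp p0 pa]] := IH (ltnW kn).
  have [||f [g [fp gp fg]]] := conn [set y in p].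
  - by rewrite inE -p0 mem_nth // sp.
  - apply/eqP => E; have := cardsT T; rewrite -E cardsE (card_uniqP up) sp cT; lia.
  rewrite !inE in fp gp.
  have gn i : (i <= k)%N -> g != nth x0 p i.
    by move=> ik; apply: contraNneq gp => ->; rewrite mem_nth // sp.
  have ik : (index f p <= k)%N by rewrite -ltnS -sp index_mem.
  have fE : nth x0 p (index f p) = f by rewrite nth_index.
  have fk : index f p = k.
    apply/eqP; rewrite eqn_leq ik leqNgt; apply/negP => ik'.
    have := inner p k (index f p) g up sp p0 pa ik'.
    rewrite fE => /(_ fg (gn _ ik')) /andP[_].
    by apply/negP/gn; lia.
  exists (rcons p g); split.
  - by rewrite rcons_uniq gp.
  - by rewrite size_rcons sp.
  - by rewrite nth_rcons sp.
  - move=> i; rewrite ltnS leq_eqVlt => /predU1P[->|ik''].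
      by rewrite !nth_rcons sp ltnn eqxx ltnSn -fk fE.
    rewrite !nth_rcons sp; have -> : (i < k.+1)%N by lia.
    have -> : (i.+1 < k.+1)%N by lia.
    exact: pa.
exists p.
have adjP i j : (i < j <= n)%N -> adj (nth x0 p i) (nth x0 p j) = (i.+1 == j).
  move=> /andP[ij jn]; have [<-|ij'] := eqVneq i.+1 j; first by apply: pa; lia.
  apply/negP => a_ij.
  have := inner p n i (nth x0 p j) up sp p0 pa.
  rewrite nth_uniq ?sp //; try lia.
  rewrite (eq_sym j) ij' => /(_ _ a_ij isT) H.
  have /andP[i0] : (0 < i)%N && (nth x0 p j == nth x0 p i.-1) by apply: H; lia.
  rewrite nth_uniq ?sp //; lia.
split => //.
  have x1p : x1 \in p.
    have /eqP E : [set y in p] == [set: T].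
      by rewrite eqEcard finset.subsetT cardsT cardsE (card_uniqP up) sp cT leqnn.
    by have := finset.in_setT x1; rewrite -E inE.
  have jn : (index x1 p <= n)%N by rewrite -ltnS -sp index_mem.
  have jE : nth x0 p (index x1 p) = x1 by rewrite nth_index.
  have [<-//|jn'] := eqVneq (index x1 p) n.
  have [j0|j0] := posnP (index x1 p).
    by move: x01; rewrite -p0 -j0 jE eqxx.
  exfalso; apply: (no2 x1 (nth x0 p (index x1 p).+1) (nth x0 p (index x1 p).-1)).
  - by rewrite eqxx orbT.
  - by rewrite -{1}jE; apply: pa; lia.
  - by rewrite -{1}jE sadj -{2}(prednK j0); apply: pa; lia.
  - by rewrite nth_uniq ?sp //; lia.
move=> i j ilen jlen; have [ij|ji|->] := ltngtP i j.
- rewrite adjP ?ij //; have -> : (j.+1 == i) = false by lia.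
  by rewrite orbF.
- rewrite sadj adjP ?ji //; have -> : (i.+1 == j) = false by lia.
  by [].
- by rewrite irr; lia.
Qed.

(** [al f l] stands for the entry of the normal of facet [f] in coordinate [l], scaled to 0, 1 or
    -1, and [mu] for the positive relation between the scaled normals; [f0] and [f1] are two facets
    that involve one coordinate each. *)
Section Counting.
Variables (R : realType) (n : nat) (al : 'I_n.+1 -> 'I_n -> R).
Variables (mu : 'I_n.+1 -> R) (f0 f1 : 'I_n.+1).
Hypothesis n2 : (2 <= n)%N.
Hypothesis al1 : forall f l, al f l != 0 -> al f l = 1 \/ al f l = -1.
Hypothesis mu0 : forall f, 0 < mu f.
Hypothesis rel_mu : forall l, \sum_f mu f * al f l = 0.
Hypothesis rel_uniq : forall nu : 'I_n.+1 -> R,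
  (forall l, \sum_f nu f * al f l = 0) -> exists K, forall f, nu f = K * mu f.
Hypothesis span : forall l, exists f, al f l != 0.
Let supp f := [set l | al f l != 0].
Let col l := [set f | al f l != 0].
Hypothesis supp2 : forall f, (#|supp f| <= 2)%N.
Hypothesis f01 : f0 != f1.
Hypothesis supp0 : #|supp f0| = 1%N.
Hypothesis supp1 : #|supp f1| = 1%N.

Lemma col_ge2 l : (2 <= #|col l|)%N.
Proof.
have [f fl] := span l.
rewrite ltnNge; apply/negP => c1.
have := rel_mu l; rewrite (bigD1 f) //= big1 ?addr0.
  by move/eqP; rewrite mulf_eq0 (negPf fl) gt_eqF.
move=> g gf; apply/eqP; rewrite mulf_eq0; apply/orP; right.
apply: contraT => gl; move: c1; rewrite leqNgt => /negP; case.
apply: (@uniq_leq_card _ _ [:: f; g]).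
  by rewrite /= inE eq_sym gf.
by move=> y; rewrite !inE => /orP[] /eqP ->.
Qed.

Lemma double_count : (\sum_l #|col l| = \sum_f #|supp f|)%N.
Proof.
have -> : (\sum_l #|col l| = \sum_l \sum_f (al f l != 0%R))%N.
  apply: eq_bigr => l _; rewrite -sum1_card big_mkcond /=.
  by apply: eq_bigr => f _; rewrite inE; case: ifP.
rewrite exchange_big /=; apply: eq_bigr => f _; rewrite -sum1_card [RHS]big_mkcond /=.
by apply: eq_bigr => l _; rewrite inE; case: ifP.
Qed.

Let b f := if (f == f0) || (f == f1) then 1%N else 2%N.

Lemma bound_sum : (\sum_f b f = n.*2)%N.
Proof.
have E f : (b f + ((f == f0) + (f == f1)) = 2)%N.
  rewrite /b; have [->|_] := eqVneq f f0; first by rewrite (negPf f01).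
  by have [_|_] := eqVneq f f1.
have : (\sum_f (b f + ((f == f0) + (f == f1))) = 2 * n.+1)%N.
  by rewrite (eq_bigr (fun=> 2%N)) // sum_nat_const card_ord mulnC.
have S (g : 'I_n.+1) : (\sum_f (f == g) = 1)%N.
  by rewrite (bigD1 g) //= eqxx big1 // => f /negPf ->.
rewrite !big_split /= !S; lia.
Qed.

Lemma supp_bound f : (#|supp f| <= b f)%N.
Proof.
rewrite /b; have [->|_] := eqVneq f f0; first by rewrite supp0.
have [->|_] := eqVneq f f1; first by rewrite supp1.
exact: supp2.
Qed.

(** The row bounds add up to 1 + 1 + 2(n - 1) = 2n and the column bounds to 2n as well, so every
    termwise inequality is an equality. *)
Lemma counts_eq : (forall l, #|col l| = 2%N) /\ (forall f, #|supp f| = b f).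
Proof.
have S1 : (\sum_(l < n) 2 <= \sum_l #|col l|)%N.
  by apply: leq_sum => l _; exact: col_ge2.
have S2 : (\sum_f #|supp f| <= \sum_f b f)%N.
  by apply: leq_sum => f _; exact: supp_bound.
have S3 : (\sum_(l < n) 2 = n.*2)%N by rewrite sum_nat_const card_ord muln2.
have E := double_count; have B := bound_sum.
split => [l|f].
- have : (\sum_l #|col l| <= \sum_(l < n) 2)%N by lia.
  rewrite (bigD1 l) //= [X in (_ <= X)%N](bigD1 l) //=.
  have S4 : (\sum_(i < n | i != l) 2 <= \sum_(i < n | i != l) #|col i|)%N.
    by apply: leq_sum => i _; exact: col_ge2.
  move=> S5; apply/eqP; rewrite eqn_leq col_ge2 andbT.
  rewrite -(leq_add2r (\sum_(i < n | i != l) 2)%N).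
  by apply: leq_trans S5; rewrite leq_add2l.
- have : (\sum_f b f <= \sum_f #|supp f|)%N by lia.
  rewrite (bigD1 f) //= [X in (_ <= X)%N](bigD1 f) //=.
  have S4 : (\sum_(i < n.+1 | i != f) #|supp i| <= \sum_(i < n.+1 | i != f) b i)%N.
    by apply: leq_sum => i _; exact: supp_bound.
  move=> S5; apply/eqP; rewrite eqn_leq supp_bound /=.
  rewrite -(leq_add2r (\sum_(i < n.+1 | i != f) #|supp i|)%N).
  by apply: leq_trans S5; rewrite leq_add2l.
Qed.

Lemma colP l f g h : f != g -> al f l != 0 -> al g l != 0 -> al h l != 0 ->
  h = f \/ h = g.
Proof.
move=> fg fl gl hl; apply: contrapT => /not_orP[/eqP hf /eqP hg].
have := @uniq_leq_card _ (col l) [:: f; g; h].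
rewrite counts_eq.1 /= !inE negb_or fg eq_sym hf eq_sym hg => /(_ isT).
have H : {subset [:: f; g; h] <= col l} by move=> y; rewrite !inE => /or3P[] /eqP ->.
by move=> /(_ H).
Qed.

(** The two nonzero entries of a column cancel with positive weights, so their signs differ. *)
Lemma col_opp l f g : f != g -> al f l != 0 -> al g l != 0 -> al g l = - al f l.
Proof.
move=> fg fl gl; have := rel_mu l.
rewrite (bigD1 f) //= (bigD1 g) 1?eq_sym //= big1 ?addr0.
  have := mu0 f; have := mu0 g.
  case: (al1 fl) => ->; case: (al1 gl) => -> //; lra.
move=> h /andP[hf hg]; apply/eqP; rewrite mulf_eq0; apply/orP; right.
apply: contraT => hl; case: (colP fg fl gl hl) => E; first by rewrite E eqxx in hf.
by rewrite E eqxx in hg.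
Qed.

Let adj f g := (f != g) && [exists l, (al f l != 0) && (al g l != 0)].

(** Every relation is a multiple of the positive one, so its support is empty or everything. Both
    [adj_uniq] and [adj_connected] contradict this by a relation of proper support. *)
Lemma relation_full nu : (forall l, \sum_f nu f * al f l = 0) ->
  (exists f, nu f != 0) -> forall f, nu f != 0.
Proof.
move=> /rel_uniq [K KE] [f]; rewrite KE mulf_eq0 negb_or => /andP[K0 _] g.
by rewrite KE mulf_neq0 // gt_eqF.
Qed.

(** With two shared coordinates the rows [f] and [g] have equal supports and opposite entries, so
    their sum is 0: a relation that misses a third row. *)
Lemma adj_uniq f g l m : f != g -> al f l != 0 -> al g l != 0 ->
  al f m != 0 -> al g m != 0 -> l = m.
Proof.
move=> fg fl gl fm gm; apply: contrapT => /eqP lm.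
have two h : al h l != 0 -> al h m != 0 -> supp h = [set l; m].
  move=> hl hm; apply/esym/eqP; rewrite eqEcard cards2 lm supp2 andbT.
  by apply/fintype.subsetP => y; rewrite !inE => /orP[] /eqP ->.
pose nu h : R := ((h == f) || (h == g))%:R.
have [h [hf hg]] : exists h, h != f /\ h != g.
  apply: contrapT => H.
  have := @uniq_leq_card _ [set f; g] (enum 'I_n.+1) (enum_uniq _).
  rewrite cards2 fg size_enum_ord => K; suff : (n.+1 <= 2)%N by lia.
  apply: K => y _; rewrite !inE; apply: contraT; rewrite negb_or => /andP[yf yg].
  by exfalso; apply: H; exists y.
have : nu h != 0; last by rewrite /nu (negPf hf) (negPf hg) eqxx.
apply: relation_full; last by exists f; rewrite /nu eqxx oner_neq0.
move=> k; rewrite (bigD1 f) //= (bigD1 g) 1?eq_sym //= big1 ?addr0; last first.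
  by move=> h' /andP[/negPf a /negPf c]; rewrite /nu a c mul0r.
rewrite /nu !eqxx orbT !mul1r.
have E : (al f k != 0) = (al g k != 0).
  have := two f fl fm; have <- := two g gl gm => /setP /(_ k); rewrite !inE //.
have [fk|fk] := boolP (al f k != 0).
  by rewrite (col_opp fg fk) ?subrr // -E.
by move: fk (fk); rewrite {2}E !negbK => /eqP -> /eqP ->; rewrite addr0.
Qed.

(** A neighbour is determined by a coordinate it shares with [f], since that column has only one
    other nonzero entry. *)
Lemma adj_degree f : (#|[set g | adj f g]| <= b f)%N.
Proof.
rewrite -counts_eq.2.
pose l0 : 'I_n := Ordinal (ltn_trans (ltnSn 0) n2).
pose c g := odflt l0 [pick l | (al f l != 0) && (al g l != 0)].
have cP g : adj f g -> (al f (c g) != 0) && (al g (c g) != 0).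
  rewrite /adj /c => /andP[_ /existsP[l Hl]]; case: pickP => //= /(_ l).
  by rewrite Hl.
rewrite -(card_in_imset (f := c)).
  apply: subset_leq_card; apply/fintype.subsetP => y /imsetP[g].
  by rewrite !inE => /cP /andP[H _] ->.
move=> g h; rewrite !inE => fg fh E.
have /andP[a1 a2] := cP g fg; have /andP[_ a3] := cP h fh.
rewrite -E in a3; have /andP[nfg _] := fg; have /andP[nfh _] := fh.
case: (colP nfg a1 a2 a3) => // E'; by rewrite E' eqxx in nfh.
Qed.

(** If no edge leaves [S], the nonzero entries of each column are all inside or all outside [S], so
    restricting [mu] to [S] gives a relation. *)
Lemma adj_connected (S : {set 'I_n.+1}) : f0 \in S -> S != [set: 'I_n.+1] ->
  exists f g, [/\ f \in S, g \notin S & adj f g].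
Proof.
move=> S0 ST; apply: contrapT => H.
pose nu h : R := (h \in S)%:R * mu h.
have : forall h, nu h != 0.
  apply: relation_full; last by exists f0; rewrite /nu S0 mul1r gt_eqF.
  move=> l; have [[f [fS fl]]|no] := pselect (exists f, f \in S /\ al f l != 0).
    rewrite -[RHS](rel_mu l); apply: eq_bigr => g _; rewrite /nu.
    have [->|gl] := eqVneq (al g l) 0; first by rewrite !mulr0.
    suff -> : g \in S by rewrite mul1r.
    apply: contraT => gS; exfalso; apply: H; exists f, g; split => //.
    have fg : f != g by apply: contraNneq gS => <-.
    by rewrite /adj fg; apply/existsP; exists l; rewrite fl.
  apply: big1 => g _; rewrite /nu.
  have [gS|] := boolP (g \in S); last by rewrite !mul0r.
  have [->|gl] := eqVneq (al g l) 0; first by rewrite mulr0.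
  by exfalso; apply: no; exists g.
move=> K; move/eqP: ST; apply; apply/setP => h; rewrite inE.
by apply: contraT => hS; have := K h; rewrite /nu (negPf hS) mul0r eqxx.
Qed.

Lemma chain_of_counting : exists s : {perm 'I_n.+1}, forall f g,
  \sum_l al f l * al g l = chain_gram R n (s f) (s g).
Proof.
have sadj : symmetric adj.
  move=> f g; rewrite /adj eq_sym; congr andb.
  by apply: eq_existsb => l; rewrite andbC.
have irr : irreflexive adj by move=> f; rewrite /adj eqxx.
have [p [up sp p0 p1 pa]] := path_enumeration (card_ord n.+1) sadj irr f01
  adj_degree adj_connected.
have pT f : f \in p.
  have /eqP E : [set y in p] == [set: 'I_n.+1].
    by rewrite eqEcard finset.subsetT cardsT cardsE (card_uniqP up) sp card_ord leqnn.
  by have := finset.in_setT f; rewrite -E inE.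
have ip f : (index f p < n.+1)%N by have := pT f; rewrite -index_mem sp.
have sinj : injective (fun f => Ordinal (ip f)).
  move=> f g /(congr1 val) /= E.
  by rewrite -(nth_index f0 (pT f)) E nth_index.
exists (perm sinj) => f g; rewrite !permE /=.
have fE := nth_index f0 (pT f); have gE := nth_index f0 (pT g).
have end0 h : (index h p == 0%N) = (h == f0).
  have hE := nth_index f0 (pT h); apply/eqP/eqP => [E|->].
    by rewrite -hE E p0.
  by rewrite -{1}p0 index_uniq // sp.
have endn h : (index h p == n) = (h == f1).
  have hE := nth_index f0 (pT h); apply/eqP/eqP => [E|->].
    by rewrite -hE E p1.
  by rewrite -{1}p1 index_uniq // sp.
rewrite /chain_gram.
have [->|fg] := eqVneq f g.
  rewrite eqxx end0 endn.
  have -> : ((index g p).+1 == index g p) = false by lia.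
  have -> : \sum_l al g l * al g l = (b g)%:R.
    rewrite -counts_eq.2 -sum1_card natr_sum [RHS]big_mkcond /=.
    apply: eq_bigr => l _; rewrite inE.
    have [->|gl] := eqVneq (al g l) 0; first by rewrite mulr0.
    by case: (al1 gl) => ->; rewrite ?mulr1 // mulrNN mulr1.
  rewrite /b; have [->|_] := eqVneq g f0; first by rewrite (negPf f01) /=; ring.
  by case: eqVneq => _ /=; ring.
have -> : (index f p == index g p) = false.
  by apply/eqP => E; move/eqP: fg; apply; rewrite -fE E gE.
(* Neighbours share exactly one coordinate, with opposite signs. *)
have -> : \sum_l al f l * al g l = - (adj f g)%:R.
  have [/andP[_ /existsP[l /andP[fl gl]]]|nadj] := boolP (adj f g).
    rewrite (bigD1 l) //= big1 ?addr0.
      rewrite (col_opp fg fl gl).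
      by case: (al1 fl) => -> /=; ring.
    move=> m ml; apply/eqP; rewrite mulf_eq0; apply: contraT.
    rewrite negb_or => /andP[fm gm].
    by move/eqP: ml; case; apply: esym; apply: (adj_uniq fg fl gl fm gm).
  rewrite big1 ?oppr0 // => l _; apply/eqP; rewrite mulf_eq0.
  apply: contraNT nadj; rewrite negb_or /adj fg => H.
  by apply/existsP; exists l.
have := pa (index f p) (index g p) (ip f) (ip g); rewrite fE gE => ->.
have : ~~ (((index f p).+1 == index g p) && ((index g p).+1 == index f p)) by lia.
by case: eqP => _; case: eqP => _ //= _; ring.
Qed.

End Counting.

Local Open Scope classical_set_scope.
Local Open Scope ring_scope.

(** * Coordinates *)

(** Both [crd] at 0 and [crd] at [n.+1] vanish in a frame; the value 1 that x_(n+1) has in the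
    description of the facets is carried by explicit terms such as [(k == n)%:R]. *)
Definition crd (R : realType) n (e : nat -> 'rV[R]_n) (v : 'rV[R]_n) (r : R)
  (k : nat) (y : 'rV[R]_n) : R := dot (e k) (y - v) / r.

Lemma frame_dot (R : realType) n (e : nat -> 'rV[R]_n) (i j : 'I_n) :
  frame e -> dot (e i.+1) (e j.+1) = (i == j)%:R.
Proof.
move=> fe; rewrite fe; [|by have := ltn_ord i; lia|by have := ltn_ord j; lia].
by rewrite (ltn_ord i) /= andbT eqSS.
Qed.

Lemma frame_expand (R : realType) n (e : nat -> 'rV[R]_n) y :
  frame e -> y = \sum_(i < n) dot (e i.+1) y *: e i.+1.
Proof.
move=> fe; pose E : 'M[R]_n := \matrix_(i < n) e i.+1.
have EE : E *m E^T = 1%:M.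
  apply/matrixP => i j; rewrite !mxE -(frame_dot i j fe).
  by apply: eq_bigr => k _; rewrite !mxE.
have EE' : E^T *m E = 1%:M by apply: mulmx1C.
rewrite -[LHS]mulmx1 -EE' mulmxA; apply/rowP => k; rewrite summxE !mxE.
apply: eq_bigr => i _; rewrite !mxE; congr (_ * _).
by apply: eq_bigr => l _; rewrite !mxE mulrC.
Qed.

Lemma frame0 (R : realType) n (e : nat -> 'rV[R]_n) : frame e -> e 0%N = 0.
Proof. by move=> fe; apply: dot_eq0; rewrite fe // andbF. Qed.

Lemma frameSn (R : realType) n (e : nat -> 'rV[R]_n) : frame e -> e n.+1 = 0.
Proof. by move=> fe; apply: dot_eq0; rewrite fe // ltnn /= andbF. Qed.

Lemma crd0 (R : realType) n (e : nat -> 'rV[R]_n) v r y :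
  frame e -> crd e v r 0 y = 0.
Proof. by move=> fe; rewrite /crd frame0 // dot0l mul0r. Qed.

Lemma crdSn (R : realType) n (e : nat -> 'rV[R]_n) v r y :
  frame e -> crd e v r n.+1 y = 0.
Proof. by move=> fe; rewrite /crd frameSn // dot0l mul0r. Qed.

Lemma crd_inj (R : realType) n (e : nat -> 'rV[R]_n) v r y y' :
  frame e -> 0 < r -> (forall i : 'I_n, crd e v r i.+1 y = crd e v r i.+1 y') ->
  y = y'.
Proof.
move=> fe r0 H; apply: (@addIr _ (- v)).
rewrite (frame_expand (y - v) fe) [RHS](frame_expand _ fe).
apply: eq_bigr => i _; congr (_ *: _).
by have /divIf := H i; apply; rewrite gt_eqF.
Qed.

Definition frame_point (R : realType) n (e : nat -> 'rV[R]_n) (v : 'rV[R]_n)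
    (r : R) (c : 'I_n -> R) : 'rV[R]_n := v + r *: \sum_i c i *: e i.+1.

Lemma crd_frame_point (R : realType) n (e : nat -> 'rV[R]_n) v r c (i : 'I_n) :
  frame e -> 0 < r -> crd e v r i.+1 (frame_point e v r c) = c i.
Proof.
move=> fe r0; rewrite /crd /frame_point addrAC subrr add0r dotZr dot_sumr.
rewrite (bigD1 i) //= dotZr frame_dot // eqxx big1 ?addr0.
  by rewrite mulr1 mulrC mulKf // gt_eqF.
by move=> j ji; rewrite dotZr frame_dot // eq_sym (negPf ji) mulr0.
Qed.

Lemma crd_reflection (R : realType) n (e : nat -> 'rV[R]_n) v r k u c y :
  crd e v r k (reflection u c y) =
  crd e v r k y - 2 * (dot u y - c) / r * dot (e k) u.
Proof. by rewrite /crd /reflection !dotE; ring. Qed.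

Lemma reflection_neq_id (R : realType) n (u : 'rV[R]_n) c :
  dot u u = 1 -> reflection u c <> id.
Proof.
move=> u1 E; have := congr1 (fun f => dot u (f 0)) E.
have := congr1 (fun f => dot u (f u)) E.
by rewrite /reflection /= !dotE u1; lra.
Qed.

Lemma reflectionK (R : realType) n (u : 'rV[R]_n) c :
  dot u u = 1 -> involutive (reflection u c).
Proof.
move=> u1 y; rewrite /reflection !dotE u1 -addrA -opprD -scalerDl.
rewrite [X in X *: u](_ : _ = 0); last by ring.
by rewrite scale0r subr0.
Qed.

Lemma reflection_fix (R : realType) n (u : 'rV[R]_n) c y :
  dot u y = c -> reflection u c y = y.
Proof. by move=> <-; rewrite /reflection subrr mulr0 scale0r subr0. Qed.

Lemma facet_reflectionsP (R : realType) n (P : simplex R n) s : (0 < n)%N ->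
  facet_reflections P s <->
  exists i, s = reflection (outward_normal P i) (offset P i).
Proof.
move=> n0; split => [[i [j [ji ->]]]|[i ->]].
  by exists i; rewrite offsetP.
by have [j ji] := other_index i n0; exists i, j; rewrite offsetP.
Qed.

Lemma generated_group_sub (T : Type) (S : set (T -> T)) (A : set (T -> T)) :
  S `<=` A -> A id -> (forall g h, A g -> A h -> A (g \o h)) ->
  (forall g h, A g -> cancel g h -> cancel h g -> A h) ->
  Defs.generated_group S `<=` A.
Proof.
move=> SA A1 AM AV g; elim => {g} [s /SA //|//|g h _ Ag _ Ah|g h _ Ag gh hg].
  exact: AM.
exact: AV Ag gh hg.
Qed.

Section AdaptedFrame.
Variables (R : realType) (n : nat) (P : simplex R n) (s : {perm 'I_n.+1}).
Variables (e : nat -> 'rV[R]_n) (v : 'rV[R]_n) (r : R).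
Hypothesis n2 : (2 <= n)%N.
Hypothesis adP : adapted_frame P s e v r.

Let n0 : (0 < n)%N. Proof. by lia. Qed.
Let fe : frame e. Proof. by case: adP. Qed.
Let r0 : 0 < r. Proof. by case: adP. Qed.
Let rN0 : r != 0. Proof. by rewrite gt_eqF. Qed.

Local Notation x := (crd e v r).

Lemma adapted_facet i y : dot (outward_normal P i) y - offset P i =
  r / root_len R n (s i) * (x (s i) y - x (s i).+1 y - (s i == n :> nat)%:R).
Proof.
have [_ _ -> ->] := adP; have := root_len_neq0 R n (s i).
move: (root_len _ _ _) => L L0; rewrite /crd /chain_root !dotE; field.
by rewrite rN0 L0.
Qed.

(** The open alcove 0 < x_1 < ... < x_n < 1. *)
Definition inside y :=
  forall k, (k <= n)%N -> x k y < x k.+1 y + (k == n)%:R.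

Lemma insideP y :
  (forall i, dot (outward_normal P i) y < offset P i) <-> inside y.
Proof.
have E i : dot (outward_normal P i) y < offset P i <->
    x (s i) y < x (s i).+1 y + (s i == n :> nat)%:R.
  rewrite -subr_lt0 adapted_facet pmulr_rlt0 ?divr_gt0 ?root_len_gt0 //.
  by rewrite -addrA -opprD subr_lt0.
split => [H k kn|H i]; last first.
  by apply/E/H; rewrite -ltnS.
have /E := H ((s^-1)%g (inord k)).
by rewrite permKV inordK.
Qed.

Lemma inside_lt y i j : inside y -> (i < j <= n.+1)%N ->
  x i y < x j y + (j == n.+1)%:R.
Proof.
move=> Iy; elim: j => [|j IH] //= /andP[ij jn].
have := Iy j; rewrite eqSS => /(_ jn) H.
have [E|ij'] := eqVneq i j; first by rewrite E.
have := IH; have -> : (j == n.+1) = false by lia.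
rewrite /= addr0 => IH'; apply: lt_trans H; apply: IH'; lia.
Qed.

Lemma inside_bound y (i : 'I_n) : inside y -> 0 < x i.+1 y < 1.
Proof.
move=> Iy; have ni := ltn_ord i.
have := @inside_lt y 0 i.+1 Iy; have := @inside_lt y i.+1 n.+1 Iy.
rewrite crd0 // crdSn // eqxx add0r.
have -> : (i.+1 == n.+1) = false by lia.
by rewrite addr0 => H1 H2; rewrite H1 ?H2 //; lia.
Qed.

Lemma inside_inj y (i j : 'I_n) : inside y -> x i.+1 y = x j.+1 y -> i = j.
Proof.
move=> Iy E; apply: val_inj => /=.
wlog ij : i j E / (i < j)%N => [H|].
  have [|ji|//] := ltngtP i j; first exact: H.
  by have := H j i (esym E) ji.
have nj := ltn_ord j; have := @inside_lt y i.+1 j.+1 Iy.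
rewrite E; have -> : (j.+1 == n.+1) = false by lia.
by rewrite addr0 ltxx => /(_ _); lia.
Qed.

(** The shape of an element of the affine Weyl group of type C_n: a signed permutation of the
    coordinates followed by a translation by even integers. *)
Definition signed_affine_perm (g : 'rV[R]_n -> 'rV[R]_n) :=
  exists (t : {perm 'I_n}) (b : 'I_n -> bool) (m : 'I_n -> int), forall y (i : 'I_n),
    x i.+1 (g y) = (-1) ^+ (b i) * x (t i).+1 y + 2 * (m i)%:~R.

Lemma adapted_reflection i y (k : 'I_n) :
  x k.+1 (reflection (outward_normal P i) (offset P i) y) =
  x k.+1 y - 2 / chain_gram R n (s i) (s i) *
    (x (s i) y - x (s i).+1 y - (s i == n :> nat)%:R) *
    ((k.+1 == s i)%:R - (k == s i :> nat)%:R).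
Proof.
rewrite crd_reflection adapted_facet; have [_ _ -> _] := adP.
have sn : (s i <= n)%N by rewrite -ltnS.
rewrite -root_len_sqr //; have := root_len_neq0 R n (s i).
move: (root_len _ _ _) => L L0; rewrite /chain_root !dotE.
rewrite !fe //; try by have := ltn_ord k; lia.
rewrite eqSS; have -> : (0 < k.+1 <= n)%N by have := ltn_ord k; lia.
by rewrite !andbT; field; rewrite rN0 L0.
Qed.

Lemma adapted_reflection0 i y (k : 'I_n) : s i = 0%N :> nat ->
  x k.+1 (reflection (outward_normal P i) (offset P i) y) =
  (-1) ^+ (k == 0%N :> nat) * x k.+1 y.
Proof.
move=> s0; rewrite adapted_reflection s0 crd0 // /chain_gram eqxx.
have -> : (0 == n)%N = false by lia.
have [->|k0] /= := eqVneq (k : nat) 0%N; last by rewrite expr0; ring.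
by rewrite expr1; field.
Qed.

Lemma adapted_reflectionn i y (k : 'I_n) : s i = n :> nat ->
  x k.+1 (reflection (outward_normal P i) (offset P i) y) =
  (-1) ^+ (k.+1 == n) * x k.+1 y + 2 * (k.+1 == n)%:R.
Proof.
move=> s0; rewrite adapted_reflection s0 crdSn // /chain_gram eqxx.
have -> : (n == 0)%N = false by lia.
have -> : (n.+1 == n)%N = false by lia.
have -> : (k == n :> nat) = false by have := ltn_ord k; lia.
have [->|k0] /= := eqVneq k.+1 n; last by rewrite expr0; ring.
by rewrite expr1; field.
Qed.

Lemma adapted_reflection_mid i y (k a b : 'I_n) :
  s i = a.+1 :> nat -> s i = b :> nat ->
  x k.+1 (reflection (outward_normal P i) (offset P i) y) =
  x (tperm a b k).+1 y.
Proof.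
move=> sa sb; rewrite adapted_reflection sb /chain_gram eqxx.
have -> : (b.+1 == b)%N = false by lia.
have -> : (b == 0 :> nat)%N = false by lia.
have -> : (b == n :> nat)%N = false by have := ltn_ord b; lia.
have ab : (a.+1 == b)%N by lia.
have -> /= : 2 / (true%:R * ((~~ false)%:R + (~~ false)%:R) - false%:R - false%:R)
  = 1 :> R by rewrite /=; field.
case: tpermP => [->|->|/eqP ka /eqP kb].
- have -> : (a == b :> nat) = false by lia.
  by rewrite ab /= -(eqP ab); ring.
- have -> : (b.+1 == b) = false by lia.
  by rewrite eqxx /= -(eqP ab); ring.
- have -> : (k == b :> nat) = false by apply: negPf.
  have -> : (k.+1 == b :> nat) = false.
    by rewrite -(eqP ab) eqSS; apply: negPf.
  by rewrite /=; ring.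
Qed.

(** The generators are the sign change of x_1, the map x_n -> 2 - x_n and the transpositions of
    neighbouring coordinates. *)
Lemma simplex_group_signed : simplex_group P `<=` signed_affine_perm.
Proof.
apply: generated_group_sub.
- move=> g /(facet_reflectionsP P _ n0) [i ->].
  have sn : (s i <= n)%N by rewrite -ltnS.
  have [s0|s0] := eqVneq (s i : nat) 0%N.
    exists 1%g, (fun k => k == 0%N :> nat), (fun=> 0) => y k.
    by rewrite adapted_reflection0 // perm1 mulr0 addr0.
  have [s1|s1] := eqVneq (s i : nat) n.
    exists 1%g, (fun k => k.+1 == n), (fun k => (k.+1 == n)%:Z) => y k.
    by rewrite adapted_reflectionn // perm1.
  have an : ((s i).-1 < n)%N by lia.
  have bn : (s i < n)%N by lia.
  exists (tperm (Ordinal an) (Ordinal bn)), (fun=> false), (fun=> 0) => y k.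
  rewrite (@adapted_reflection_mid _ _ _ (Ordinal an) (Ordinal bn)) //=; last by lia.
  by rewrite expr0; ring.
- exists 1%g, (fun=> false), (fun=> 0) => y k; rewrite perm1 expr0; ring.
- move=> g h [t [b [m gE]]] [t' [b' [m' hE]]].
  exists (t * t')%g, (fun i => b i (+) b' (t i)),
    (fun i => (-1) ^+ (b i) * m' (t i) + m i) => y i.
  rewrite /= gE hE permM signr_addb intrD intrM rmorphXn /= rmorphN1.
  by ring.
- move=> g h [t [b [m gE]]] gh hg.
  exists (t^-1)%g, (fun i => b (t^-1 i)%g),
   (fun i => - (-1) ^+ (b (t^-1 i)%g) * m (t^-1 i)%g) => y i.
  have := gE (h y) (t^-1 i)%g; rewrite hg permKV => ->.
  rewrite mulrDr mulrA -signr_addb addbb expr0 intrM rmorphN rmorphXn /= rmorphN1.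
  by ring.
Qed.

(* The numbers [+- x_j + 2m] are pairwise distinct at an inside point. *)
Lemma signed_fix_inside g y : signed_affine_perm g -> inside y -> g y = y ->
  g = id.
Proof.
move=> [t [b [m gE]]] Iy gy.
have K i : [/\ t i = i, b i = false & m i = 0].
  have := gE y i; rewrite gy.
  have /andP[a0 a1] := inside_bound i Iy.
  have /andP[c0 c1] := inside_bound (t i) Iy => E.
  have m0 : m i = 0.
    have : ((-1)%:~R < (m i)%:~R :> R) && ((m i)%:~R < 1%:~R :> R).
      rewrite rmorphN1 rmorph1.
      by case: (b i) E; rewrite ?expr1 ?expr0; lra.
    by rewrite !ltr_int; lia.
  move: E; rewrite m0 mulr0 addr0.
  case: (b i); rewrite ?expr1 ?expr0 ?mul1r => E.
    suff : ~~ (0 < x i.+1 y) by rewrite a0.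
    by rewrite -leNgt E; lra.
  by split => //; apply: (inside_inj Iy).
apply/funext => z; apply: (@crd_inj _ _ e v r _ _ fe r0) => i.
by rewrite gE; have [-> -> ->] := K i; rewrite expr0; ring.
Qed.

End AdaptedFrame.

(** * Coxeter simplices generate *)

#[local] Instance rV_nbhs_filter (R : realType) n (y : 'rV[R]_n) :
  Filter (nbhs y) := nbhs_filter y.

Lemma continuous_dot (R : realType) n (u : 'rV[R]_n) : continuous (dot u).
Proof.
suff H (r : seq 'I_n) : continuous (fun y : 'rV[R]_n => \sum_(i <- r) u 0 i * y 0 i).
  exact: H.
elim: r => [|i r IH] y.
  have -> : (fun y : 'rV[R]_n => \sum_(i <- [::]) u 0 i * y 0 i) = (fun=> 0).
    by apply/funext => z; rewrite big_nil.
  exact: cvg_cst.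
have -> : (fun y : 'rV[R]_n => \sum_(j <- i :: r) u 0 j * y 0 j) =
    (fun y => u 0 i * y 0 i + \sum_(j <- r) u 0 j * y 0 j).
  by apply/funext => z; rewrite big_cons.
apply: cvgD; last exact: IH.
by apply: cvgM; [exact: cvg_cst|exact: coord_continuous].
Qed.

Lemma continuous_crd (R : realType) n (e : nat -> 'rV[R]_n) v r k :
  continuous (crd e v r k).
Proof.
have -> : crd e v r k = (fun y => (dot (e k) y - dot (e k) v) / r).
  by apply/funext => y; rewrite /crd dotBr.
move=> y; apply: cvgM; last exact: cvg_cst.
by apply: cvgB; [exact: continuous_dot|exact: cvg_cst].
Qed.

Lemma continuous_line (R : realType) n (a w : 'rV[R]_n) :
  continuous (fun t : R => a + t *: w).
Proof.
move=> t; apply: cvgD; first exact: cvg_cst.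
by apply: cvgZr_tmp; exact: cvg_id.
Qed.

Lemma star_connected (R : realType) n (A : set 'rV[R]_n) a : A a ->
  (forall y, A y -> forall t, 0 <= t <= 1 -> A (a + t *: (y - a))) ->
  connected A.
Proof.
move=> Aa H.
have -> : A = \bigcup_(y in A) ((fun t => a + t *: (y - a)) @` `[0 : R, 1]).
  apply/seteqP; split => y.
    move=> Ay; exists y => //; exists 1; first by rewrite /= in_itv /= ler01 lexx.
    by rewrite scale1r addrC subrK.
  by move=> [z Az [t + <-]]; rewrite /= in_itv /=; exact: H.
apply: bigcup_connected.
  exists a => y _; exists 0; first by rewrite /= in_itv /= ler01 lexx.
  by rewrite scale0r addr0.
move=> y Ay; apply: connected_continuous_connected.
  by apply/connected_intervalP; exact: interval_is_interval.
by apply: continuous_subspaceT; exact: continuous_line.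
Qed.

(** The values of [dot u] on a connected set form an interval; this is how a chamber is kept on one
    side of each mirror. *)
Lemma connected_side (R : realType) n (A : set 'rV[R]_n) u c a : connected A ->
  (forall y, A y -> dot u y <> c) -> A a -> dot u a < c ->
  forall y, A y -> dot u y < c.
Proof.
move=> cA Ac Aa ac y Ay; rewrite ltNge; apply/negP => cy.
have /connected_intervalP I : connected (dot u @` A).
  apply: connected_continuous_connected => //.
  by apply: continuous_subspaceT; exact: continuous_dot.
have [|||z Az /(Ac _ Az) //] := I (dot u a) (dot u y) _ _ c.
- by exists a.
- by exists y.
- by rewrite (ltW ac) cy.
Qed.

Definition open_simplex (R : realType) n (P : simplex R n) : set 'rV[R]_n :=
  [set y | forall i, dot (outward_normal P i) y < offset P i].

Lemma open_simplex_nonempty (R : realType) n (P : simplex R n) : (0 < n)%N ->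
  exists y, open_simplex P y.
Proof.
move=> n0; pose c (i : 'I_n.+1) : R := n.+1%:R^-1.
have c1 : \sum_i c i = 1.
  by rewrite sumr_const card_ord -[_ *+ _]mulr_natr mulVf // pnatr_eq0.
exists (\sum_i c i *: P i) => i; rewrite -subr_gt0 barycentric_normal //.
by rewrite mulr_gt0 ?height_gt0 // invr_gt0 ltr0n.
Qed.

Lemma open_simplex_line (R : realType) n (P : simplex R n) a y t : (0 < n)%N ->
  open_simplex P a -> body P y -> 0 <= t < 1 ->
  open_simplex P (a + t *: (y - a)).
Proof.
move=> n0 Pa /(bodyP P y n0) Py /andP[t0 t1] i.
rewrite !dotE; have := Pa i; have := Py i; nra.
Qed.

Lemma open_simplex_body (R : realType) n (P : simplex R n) : (0 < n)%N ->
  open_simplex P `<=` body P.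
Proof. by move=> n0 y Py; apply/bodyP => // i; apply/ltW/Py. Qed.

Lemma open_simplex_connected (R : realType) n (P : simplex R n) : (0 < n)%N ->
  connected (open_simplex P).
Proof.
move=> n0; have [a Pa] := open_simplex_nonempty P n0.
apply: (star_connected Pa) => y Py t /andP[t0].
rewrite le_eqVlt => /predU1P[->|t1]; first by rewrite scale1r addrC subrK.
apply: open_simplex_line => //; first exact: open_simplex_body.
by rewrite t0.
Qed.

Lemma closed_halfspace (R : realType) n (u : 'rV[R]_n) c :
  closed [set y | dot u y <= c].
Proof.
apply: (@closed_comp _ _ (dot u) [set z | z <= c]).
  by move=> y _; exact: continuous_dot.
exact: closed_le.
Qed.

Lemma body_closed (R : realType) n (P : simplex R n) : (0 < n)%N ->
  closed (body P).
Proof.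
move=> n0; have -> : body P =
    \bigcap_(i in [set: 'I_n.+1]) [set y | dot (outward_normal P i) y <= offset P i].
  apply/seteqP; split => y; first by move/(bodyP P y n0) => H i _; exact: H.
  by move=> H; apply/bodyP => // i; exact: H.
by apply: closed_bigI => i _; exact: closed_halfspace.
Qed.

Lemma nbhs_line (R : realType) n (a w : 'rV[R]_n) (U : set 'rV[R]_n) :
  nbhs a U -> exists2 d : R, 0 < d & forall t, `|t| < d -> U (a + t *: w).
Proof.
move=> aU.
have : nbhs (0 : R) ((fun t : R => a + t *: w) @^-1` U).
  by apply: continuous_line; rewrite scale0r addr0.
move=> /nbhs_ballP[d /= d0 dU]; exists d => // t td; apply: dU.
by rewrite /ball /= sub0r normrN.
Qed.

Lemma open_simplex_closure (R : realType) n (P : simplex R n) : (0 < n)%N ->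
  closure (open_simplex P) = body P.
Proof.
move=> n0; apply/seteqP; split.
  rewrite (closure_id (body P)).1; last exact: body_closed.
  by apply: closure_subset; exact: open_simplex_body.
move=> y Py U yU; have [a Pa] := open_simplex_nonempty P n0.
have [d d0 dU] := nbhs_line (a - y) yU.
pose t := Num.min (d / 2) 1.
have t0 : 0 < t by rewrite lt_min ltr01 divr_gt0.
have td : t < d by rewrite gt_min ltr_pdivrMr // ltr_pMr // ltr1n.
have t1 : t <= 1 by rewrite ge_min lexx orbT.
exists (y + t *: (a - y)); split; last by apply: dU; rewrite gtr0_norm.
have -> : y + t *: (a - y) = a + (1 - t) *: (y - a).
  apply/rowP => i; rewrite !mxE; ring.
by apply: open_simplex_line => //; lra.
Qed.

Lemma is_mirror_facet (R : realType) n (P : simplex R n) i : (0 < n)%N ->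
  is_mirror (simplex_group P) (hyperplane (outward_normal P i) (offset P i)).
Proof.
move=> n0; exists (outward_normal P i), (offset P i); split => //.
  by apply/enorm1P; rewrite normal_unit.
by apply: generated_gen; apply/facet_reflectionsP => //; exists i.
Qed.

(** The facets are mirrors, so a component starting inside cannot cross them; the open simplex is
    connected and free of mirrors, so it fills that component. *)
Lemma chamber_of_no_mirror_inside (R : realType) n (P : simplex R n) :
  (0 < n)%N ->
  (forall u c y, dot u u = 1 -> simplex_group P (reflection u c) ->
     open_simplex P y -> dot u y <> c) ->
  fundamental_chamber (simplex_group P) (body P).
Proof.
move=> n0 H; have [a Pa] := open_simplex_nonempty P n0.
have PM : open_simplex P `<=` mirror_complement (simplex_group P).
  move=> y Py [M [u [c [/enorm1P u1 -> Gu]]]].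
  exact: H Gu Py.
exists a; first exact: PM.
rewrite -open_simplex_closure //; congr closure; apply/seteqP; split.
  apply: connected_component_max => //; exact: open_simplex_connected.
move=> y Cy i.
apply: (@connected_side _ _ _ _ _ a _ _ _ (Pa i) y Cy).
- exact: component_connected.
- move=> z /connected_component_sub Mz E; apply: Mz.
  exists (hyperplane (outward_normal P i) (offset P i)) => //.
  exact: is_mirror_facet.
- by apply: connected_component_refl; exact: PM.
Qed.

(* The coordinates [j.+1 / n.+1] of the test point used for discreteness, with
   denominators cleared. *)
Lemma generic_separation (n : nat) (b b' : bool) (j j' : 'I_n) (m m' : int) :
  (-1) ^+ b * j.+1%:Z + 2 * m * n.+1%:Z =
  (-1) ^+ b' * j'.+1%:Z + 2 * m' * n.+1%:Z :> int ->
  [/\ b = b', j = j' & m = m'].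
Proof.
have jn := ltn_ord j; have jn' := ltn_ord j'.
case: b; case: b' => E; rewrite ?expr1 ?expr0 in E.
all: have mm : m = m' by nia.
all: move: E; rewrite mm => E.
- by split => //; apply: ord_inj; lia.
- by exfalso; lia.
- by exfalso; lia.
- by split => //; apply: ord_inj; lia.
Qed.

(** The images of one test point already tell the elements of the group apart, by at least
    [1 / n.+1] in some coordinate, and a neighbourhood for pointwise convergence may constrain that
    point alone. *)
Lemma adapted_discrete (R : realType) n (P : simplex R n) s e v r : (2 <= n)%N ->
  adapted_frame P s e v r -> discrete_group (simplex_group P).
Proof.
move=> n2 ad; have n0 : (0 < n)%N by lia.
have [fe r0 _ _] := ad.
apply/seteqP; split => [g|g Gg]; first exact: isolatedS.
split; first exact/mem_set.
pose p := frame_point e v r (fun i : 'I_n => i.+1%:R / n.+1%:R).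
pose V : set {ptws 'rV[R]_n -> 'rV[R]_n} := [set h : 'rV[R]_n -> 'rV[R]_n |
  forall i : 'I_n, `|crd e v r i.+1 (h p) - crd e v r i.+1 (g p)| < n.+1%:R^-1].
exists V.
  have W : nbhs (g p) [set z | forall i : 'I_n,
      `|crd e v r i.+1 z - crd e v r i.+1 (g p)| < n.+1%:R^-1].
    apply: (@filter_forall _ _ _ _ (nbhs_filter (g p : 'rV[R]_n))) => i.
    have d0 : 0 < n.+1%:R^-1 :> R by rewrite invr_gt0 ltr0n.
    have := @continuous_crd R n e v r i.+1 (g p) _ (nbhsx_ballx _ _ d0).
    by apply: (@filterS _ _ (nbhs_filter (g p : 'rV[R]_n))) => z; rewrite /ball /= distrC.
  exact: (@proj_continuous _ (fun=> 'rV[R]_n) p g _ W).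
apply/seteqP; split => [h [Vh Gh]|_ ->]; last first.
  by split => // i; rewrite subrr normr0 invr_gt0 ltr0n.
have [t [b [m gE]]] := simplex_group_signed n2 ad Gg.
have [t' [b' [m' hE]]] := simplex_group_signed n2 ad Gh.
have K i : [/\ b' i = b i, t' i = t i & m' i = m i].
  apply: (@generic_separation n).
  have := Vh i; rewrite gE hE !crd_frame_point //.
  set A := (X in X = _); set B := (X in _ = X).
  have -> : (-1) ^+ b' i * ((t' i).+1%:R / n.+1%:R) + 2 * (m' i)%:~R -
     ((-1) ^+ b i * ((t i).+1%:R / n.+1%:R) + 2 * (m i)%:~R) =
     (A - B)%:~R / n.+1%:R :> R.
    rewrite /A /B rmorphB !rmorphD !rmorphM !rmorphXn !rmorphN1 /=.
    rewrite -!pmulrn.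
    have : n.+1%:R != 0 :> R by rewrite pnatr_eq0.
    by move: (n.+1%:R : R) => N N0; field.
  rewrite normrM normfV normr_nat ltr_pdivrMr ?ltr0n // mulVf ?pnatr_eq0 //.
  by rewrite -intr_norm -(mulr1z 1) ltr_int; lia.
apply/funext => y; apply: (@crd_inj _ _ e v r _ _ fe r0) => i.
by rewrite gE hE; have [-> -> ->] := K i.
Qed.

(** A reflection of the group whose mirror meets the open simplex would fix an inside point, hence
    be the identity. *)
Lemma coxeter_generates (R : realType) n (P : simplex R n) : (2 <= n)%N ->
  coxeter_C_tilde P -> generates_C_tilde P.
Proof.
move=> n2 cP; have n0 : (0 < n)%N by lia.
have [s [e [v [r ad]]]] := adapted_frame_exists n2 cP.
split; first exact: adapted_discrete ad.
exists P => //; apply: chamber_of_no_mirror_inside => // u c y u1 Gu Py uy.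
apply: (@reflection_neq_id R n u c u1).
have [fe r0 _ _] := ad.
apply: (signed_fix_inside n2 ad (simplex_group_signed n2 ad Gu) (y := y)).
  exact/(insideP ad).
exact: reflection_fix.
Qed.

(** * Mirrors of a discrete group *)

Lemma cvg_dot (R : realType) n (T : Type) (F : set_system T) (FF : Filter F)
    (f g : T -> 'rV[R]_n) a b :
  f @ F --> a -> g @ F --> b -> (fun t => dot (f t) (g t)) @ F --> dot a b.
Proof.
move=> fa gb.
suff H (r : seq 'I_n) : (fun t => \sum_(i <- r) f t 0 i * g t 0 i) @ F -->
    \sum_(i <- r) a 0 i * b 0 i by exact: H.
elim: r => [|i r IH].
  have -> : (fun t => \sum_(i <- [::]) f t 0 i * g t 0 i) = (fun=> 0).
    by apply/funext => z; rewrite big_nil.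
  by rewrite big_nil; exact: cvg_cst.
have -> : (fun t => \sum_(j <- i :: r) f t 0 j * g t 0 j) =
    (fun t => f t 0 i * g t 0 i + \sum_(j <- r) f t 0 j * g t 0 j).
  by apply/funext => z; rewrite big_cons.
rewrite big_cons; apply: cvgD => //; apply: cvgM.
  exact: (cvg_comp _ _ fa (@coord_continuous _ _ _ 0 i a)).
exact: (cvg_comp _ _ gb (@coord_continuous _ _ _ 0 i b)).
Qed.

Lemma cvg_reflection (R : realType) n (T : Type) (F : set_system T)
    (FF : Filter F) (u y : T -> 'rV[R]_n) (c : T -> R) u0 c0 y0 :
  u @ F --> u0 -> c @ F --> c0 -> y @ F --> y0 ->
  (fun t => reflection (u t) (c t) (y t)) @ F --> reflection u0 c0 y0.
Proof.
move=> uF cF yF; apply: cvgB => //; apply: cvgZ => //.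
apply: cvgM; first exact: cvg_cst.
by apply: cvgB => //; exact: cvg_dot.
Qed.

Lemma reflection_inj (R : realType) n (u u' : 'rV[R]_n) c c' :
  dot u u = 1 -> dot u' u' = 1 -> reflection u c = reflection u' c' ->
  (u = u' /\ c = c') \/ (u = - u' /\ c = - c').
Proof.
move=> u1 u1' E.
have K y : (dot u y - c) *: u = (dot u' y - c') *: u'.
  have /(congr1 (fun f => f y)) := E.
  rewrite /reflection => /addrI /oppr_inj.
  rewrite -!scalerA; apply: scalerI; by rewrite pnatr_eq0.
have c0 : c *: u = c' *: u'.
  by have := K 0; rewrite !dot0r !sub0r !scaleNr => /oppr_inj.
have uu : u = dot u' u *: u'.
  have := K u; rewrite !scalerBl c0 => /addIr.
  by rewrite u1 scale1r.
have sq : dot u u' ^+ 2 = 1.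
  by rewrite -[RHS]u1 [in RHS]uu dotZl dotZr u1' (dotC u); ring.
have [E1|E1] := unit_parallel u1 u1' sq; [left|right]; split => //.
  by have /(congr1 (dot u')) := c0; rewrite !dotZr E1 u1' !mulr1.
have /(congr1 (dot u')) := c0; rewrite !dotZr E1 dotNr u1' mulrN !mulr1.
by move=> <-; rewrite opprK.
Qed.

Lemma reflectionN (R : realType) n (u : 'rV[R]_n) c :
  reflection (- u) (- c) = reflection u c.
Proof.
apply/funext => y; rewrite /reflection dotNl -opprD mulrN scaleNr scalerN.
by rewrite opprK.
Qed.

Lemma real_set1_closed (R : realType) (c : R) : closed [set c].
Proof. exact/accessible_closed_set1/hausdorff_accessible/Rhausdorff. Qed.

Lemma sphere_compact (R : realType) n : compact [set u : 'rV[R]_n | dot u u = 1].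
Proof.
have box : compact [set u : 'rV[R]_n | forall i, `[(-1), 1]%classic (u ord0 i)].
  have H := @rV_compact R n (fun=> `[(-1), 1]%classic).
  by apply: H => i; exact: segment_compact.
have cl : closed [set u : 'rV[R]_n | dot u u = 1].
  apply: (@closed_comp _ _ (fun u : 'rV[R]_n => dot u u) [set 1 : R]).
    by move=> u _; apply: cvg_dot; exact: cvg_id.
  exact: real_set1_closed.
rewrite (_ : mkset _ = [set u : 'rV[R]_n | forall i, `[(-1), 1]%classic (u ord0 i)]
   `&` [set u | dot u u = 1]); first exact: compact_closedI.
apply/seteqP; split => u /=; last by case.
move=> u1; split => // i; rewrite /= in_itv /= -ler_norml.
rewrite -(@expr_le1 _ 2) // real_normK ?num_real // -u1 /dot (bigD1 i) //=.
by rewrite -expr2 lerDl sumr_ge0 // => j _; rewrite -expr2 sqr_ge0.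
Qed.

(* Two reflections of [G] close to a common one have a product close to the
   identity, hence equal to it. *)
Lemma local_reflections_eq (R : realType) n
    (G : set ('rV[R]_n -> 'rV[R]_n)) (q : 'rV[R]_n * R) :
  discrete_group G -> G id -> (forall g h, G g -> G h -> G (g \o h)) ->
  dot q.1 q.1 = 1 ->
  exists2 V, nbhs q V & forall p p', V p -> V p' ->
    dot p.1 p.1 = 1 -> dot p'.1 p'.1 = 1 ->
    G (reflection p.1 p.2) -> G (reflection p'.1 p'.2) -> p = p'.
Proof.
move=> dG G1 GM q1.
have [_ [V Vid VG]] : isolated (G : set {ptws 'rV[R]_n -> 'rV[R]_n}) id.
  by rewrite dG.
pose Phi (p : ('rV[R]_n * R) * ('rV[R]_n * R)) : {ptws 'rV[R]_n -> 'rV[R]_n} :=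
  reflection p.1.1 p.1.2 \o reflection p.2.1 p.2.2.
have PhiV : nbhs (q, q) (Phi @^-1` V).
  have : Phi @ nbhs (q, q) --> (id : {ptws 'rV[R]_n -> 'rV[R]_n}).
    apply/pointwise_cvgP => t /=.
    suff : (fun p : ('rV[R]_n * R) * ('rV[R]_n * R) => Phi p t) @ nbhs (q, q) -->
        reflection q.1 q.2 (reflection q.1 q.2 t) by rewrite reflectionK.
    have c1 : (fun p : ('rV[R]_n * R) * ('rV[R]_n * R) => p.1) @ nbhs (q, q) --> q.
      exact: cvg_fst.
    have c2 : (fun p : ('rV[R]_n * R) * ('rV[R]_n * R) => p.2) @ nbhs (q, q) --> q.
      exact: cvg_snd.
    have f1 : (fun p : 'rV[R]_n * R => p.1) @ nbhs q --> q.1 by exact: cvg_fst.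
    have f2 : (fun p : 'rV[R]_n * R => p.2) @ nbhs q --> q.2 by exact: cvg_snd.
    apply: (@cvg_reflection R n _ _ (nbhs_filter (q, q))).
    - exact: (cvg_comp _ _ c1 f1).
    - exact: (cvg_comp _ _ c1 f2).
    apply: (@cvg_reflection R n _ _ (nbhs_filter (q, q))).
    - exact: (cvg_comp _ _ c2 f1).
    - exact: (cvg_comp _ _ c2 f2).
    - exact: cvg_cst.
  by apply.
have [[A B] /= [qA qB] AB] := PhiV.
(* The pairs (u, c) and (-u, -c) give the same reflection; a half-space of normals around [q.1]
   retains only one of them. *)
pose S : set ('rV[R]_n * R) := [set p | 0 < dot q.1 p.1].
have qS : nbhs q S.
  have H : (fun p : 'rV[R]_n * R => dot q.1 p.1) @ nbhs q --> dot q.1 q.1.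
    apply: cvg_dot; first exact: cvg_cst.
    exact: (@cvg_fst _ _ (nbhs q.1) (nbhs q.2) _).
  rewrite q1 in H; apply: (H [set x | 0 < x]).
  exact: lt_nbhsr.
exists (A `&` B `&` S); first by apply: filterI => //; apply: filterI.
move=> p p' [[Ap _] Sp] [[_ Bp'] Sp'] p1 p1' Gp Gp'.
have : (V `&` G) (Phi (p, p')) by split; [exact: AB|exact: GM].
rewrite VG /= => E.
have E' : reflection p.1 p.2 = reflection p'.1 p'.2.
  apply/funext => y; have := congr1 (fun f => f (reflection p'.1 p'.2 y)) E.
  by rewrite /Phi /= reflectionK.
have [[]|[e1 _]] := reflection_inj p1 p1' E'.
  by case: p p' {Ap Sp Bp' Sp' p1 p1' Gp Gp' E E'} => [a b] [a' b'] /= -> ->.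
by move: Sp Sp'; rewrite /S /= e1 dotNr oppr_gt0 => /lt_trans h /h; rewrite ltxx.
Qed.

(** Pairs of a unit normal and a bounded level form a compact set, covered by neighbourhoods each
    containing at most one pair that comes from [G]. *)
Lemma finitely_many_mirrors (R : realType) n (G : set ('rV[R]_n -> 'rV[R]_n)) K :
  discrete_group G -> G id -> (forall g h, G g -> G h -> G (g \o h)) ->
  finite_set [set p : 'rV[R]_n * R | [/\ dot p.1 p.1 = 1, `|p.2| <= K &
    G (reflection p.1 p.2)]].
Proof.
move=> dG G1 GM.
pose D : set ('rV[R]_n * R) := [set u : 'rV[R]_n | dot u u = 1] `*` `[(- K), K]%classic.
have cD : compact D.
  by apply: compact_setX; [exact: sphere_compact|exact: segment_compact].
have HV (q : 'rV[R]_n * R) : exists V, D q -> nbhs q V /\ forall p p', V p -> V p' ->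
    dot p.1 p.1 = 1 -> dot p'.1 p'.1 = 1 ->
    G (reflection p.1 p.2) -> G (reflection p'.1 p'.2) -> p = p'.
  have [[q1 q2]|nD] := pselect (D q); last by exists setT.
  by have [V qV H] := local_reflections_eq dG G1 GM q1; exists V.
have [V VP] := choice HV.
(* The cover criterion for compactness is applied to a pointed space, whence the arbitrary base
   point. *)
pose T : ptopologicalType := HB.pack ('rV[R]_n * R)%type
  (Topological.on ('rV[R]_n * R)%type) (isPointed.Build ('rV[R]_n * R)%type (0, 0)).
have cov0 := cD; rewrite (@compact_cover T) in cov0.
have [||D' D'D cov] := cov0 _ D (fun q => (V q)°).
- by move=> q Dq; exact: open_interior.
- move=> q Dq; exists q => //; exact: (VP q Dq).1.
move: cov; set D0 := (X in cover X _) => cov.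
set S := mkset _.
have SE : S `<=` \bigcup_(q in D0) (S `&` V q).
  move=> p [p1 pK Gp].
  have [|q D'q Vq] := cov p; first by split => //=; rewrite in_itv /= -ler_norml.
  by exists q => //; split => //; exact: interior_subset.
apply: sub_finite_set SE _; apply: bigcup_finite; first exact: finite_fset.
move=> q D'q; have Dq : D q by apply/set_mem/D'D.
have [->|/set0P[p [Sp Vp]]] := eqVneq (S `&` V q) set0; first exact: finite_set0.
apply: sub_finite_set (finite_set1 p) => p' [Sp' Vp'].
by case: Sp Sp' => [? _ ?] [? _ ?]; apply: (VP q Dq).2.
Qed.

(** A finite form of Baire's argument: each set is closed and nowhere dense in [H], so they can be
    avoided one after the other while the open set shrinks. *)
Lemma generic_avoid (T : topologicalType) (I : eqType) (l : seq I)
    (Z : I -> set T) (H U : set T) : open U -> H `&` U !=set0 ->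
  (forall i, i \in l -> closed (Z i) /\ forall U', open U' ->
     H `&` U' !=set0 -> H `&` U' `\` Z i !=set0) ->
  exists y, [/\ H y, U y & forall i, i \in l -> ~ Z i y].
Proof.
elim: l U => [|i l IH] U oU HU HZ.
  by have [y [Hy Uy]] := HU; exists y; split.
have [ci di] := HZ i (mem_head _ _).
have [||j jl|y [Hy [Uy Ziy] Zy]] := IH (U `&` ~` Z i).
- by apply: openI => //; rewrite openC.
- by have [y [[Hy Uy] Zy]] := di U oU HU; exists y.
- by apply: HZ; rewrite inE jl orbT.
exists y; split => // j; rewrite inE => /predU1P[->//|]; exact: Zy.
Qed.

(** If [u] is not parallel to [f], a small move along the part of [u] orthogonal to [f] stays in the
    hyperplane and leaves the isolated level. If [u] is [f] or [- f], its level on the hyperplane is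
    [a] or [- a], outside [D]. *)
Lemma levels_nowhere_dense (R : realType) n (f u : 'rV[R]_n) a (D : set R) :
  dot f f = 1 -> dot u u = 1 ->
  (forall c, D c -> exists2 d, 0 < d & forall c', 0 < `|c' - c| < d -> ~ D c') ->
  ~ (u = f /\ D a) -> ~ (u = - f /\ D (- a)) ->
  forall U, open U -> hyperplane f a `&` U !=set0 ->
    hyperplane f a `&` U `\` [set y | D (dot u y)] !=set0.
Proof.
move=> f1 u1 isoD n1 n2 U oU [y [/= Hy Uy]].
have [Dy|nDy] := pselect (D (dot u y)); last by exists y.
pose w := u - dot u f *: f.
have fw : dot f w = 0 by rewrite /w dotBr dotZr f1 mulr1 dotC subrr.
have uw : dot u w = 1 - dot u f ^+ 2.
  by rewrite /w dotBr dotZr u1 -expr2.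
have uw0 : dot u w != 0.
  apply/eqP => E; have sq : dot u f ^+ 2 = 1 by move: E; rewrite uw; lra.
  have [E1|E1] := unit_parallel u1 f1 sq.
    by apply: n1; split => //; rewrite -Hy -E1.
  by apply: n2; split => //; rewrite -Hy -dotNl -E1.
have [d d0 dD] := isoD _ Dy.
have [d' d'0 d'U] := nbhs_line w (open_nbhs_nbhs (conj oU Uy)).
pose t := Num.min (d' / 2) (d / 2 / `|dot u w|).
have t0 : 0 < t by rewrite lt_min !divr_gt0 // normr_gt0.
have t1 : t < d' by rewrite gt_min ltr_pdivrMr // ltr_pMr // ltr1n.
have t2 : t * `|dot u w| < d.
  apply: (@le_lt_trans _ _ (d / 2)).
    by rewrite -ler_pdivlMr ?normr_gt0 // ge_min lexx orbT.
  by rewrite ltr_pdivrMr // ltr_pMr // ltr1n.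
exists (y + t *: w); split; [split|] => /=.
- by rewrite /hyperplane /= dotDr dotZr fw mulr0 addr0.
- by apply: d'U; rewrite gtr0_norm.
- apply: dD; rewrite dotDr dotZr addrAC subrr add0r normrM (gtr0_norm t0) t2 andbT.
  by rewrite mulr_gt0 // normr_gt0.
Qed.

Lemma closed_levels (R : realType) n (u : 'rV[R]_n) (D : set R) :
  closed D -> closed [set y | D (dot u y)].
Proof.
by move=> cD; apply: (@closed_comp _ _ (dot u) D) => // y _; exact: continuous_dot.
Qed.

Lemma open_finite_bigcap (T : topologicalType) (I : choiceType) (A : set I)
    (f : I -> set T) : finite_set A -> (forall i, A i -> open (f i)) ->
  open (\bigcap_(i in A) f i).
Proof.
move=> fA of_; rewrite -closedC setC_bigcap; apply: closed_bigcup => // i Ai.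
by rewrite closedC; exact: of_.
Qed.

Lemma open_simplex_open (R : realType) n (P : simplex R n) (D : pred 'I_n.+1) :
  open [set y | forall i, D i -> dot (outward_normal P i) y < offset P i].
Proof.
have -> : [set y | forall i, D i -> dot (outward_normal P i) y < offset P i] =
    \bigcap_(i in [set` D]) [set y | dot (outward_normal P i) y < offset P i].
  by apply/seteqP; split => y H i; exact: H.
apply: open_finite_bigcap; first exact: finite_finset.
move=> i _; apply: (@open_comp _ _ (dot (outward_normal P i)) [set z | z < offset P i]).
  by move=> y _; exact: continuous_dot.
exact: open_lt.
Qed.

(** * Interior and walls of a chamber *)

Section Chamber.
Variables (R : realType) (n : nat) (G : set ('rV[R]_n -> 'rV[R]_n)).
Variable (Q : simplex R n).
Hypothesis n0 : (0 < n)%N.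
Hypothesis dG : discrete_group G.
Hypothesis G1 : G id.
Hypothesis GM : forall g h, G g -> G h -> G (g \o h).
Hypothesis chQ : fundamental_chamber G (body Q).

Lemma mirror_complementP y : mirror_complement G y <->
  forall u c, dot u u = 1 -> G (reflection u c) -> dot u y <> c.
Proof.
split=> [My u c u1 Gu uy|H [M [u [c [/enorm1P u1 -> Gu]]]]]; last exact: H.
apply: My; exists (hyperplane u c) => //; exists u, c; split => //.
exact/enorm1P.
Qed.

(** The component lies on one side of the mirror, so its closure [body Q] lies in a closed
    half-space; a mirror through the open simplex would leave points of [body Q] beyond it. *)
Lemma no_mirror_inside u c y : dot u u = 1 -> G (reflection u c) ->
  open_simplex Q y -> dot u y <> c.
Proof.
have [x Mx QC] := chQ; move=> + + Qy.
set C := connected_component _ _ in QC.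
have Cx : C x by exact: connected_component_refl.
have cC : connected C by exact: component_connected.
wlog xc : u c / dot u x < c.
  move=> H u1 Gu uy; have := (mirror_complementP x).1 Mx u c u1 Gu.
  move=> /eqP; rewrite neq_lt => /orP[xc|cx]; first exact: (H u c).
  apply: (H (- u) (- c)); rewrite ?dotNl ?dotNr ?opprK ?reflectionN ?ltrN2 //.
  by rewrite uy.
move=> u1 Gu uy.
have Cu z : C z -> dot u z < c.
  apply: (@connected_side _ _ C u c x) => //.
  move=> {}z /connected_component_sub /mirror_complementP; exact.
have : body Q `<=` [set z | dot u z <= c].
  rewrite QC (closure_id [set z | dot u z <= c]).1; last exact: closed_halfspace.
  by apply: closure_subset => z /Cu /ltW.
have oQ : nbhs y (open_simplex Q).
  apply: open_nbhs_nbhs; split => //.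
  have := @open_simplex_open R n Q predT; congr open.
  by apply/seteqP; split => z H i; [apply: H|move=> _; apply: H].
have [d d0 dQ] := nbhs_line u oQ => /(_ (y + (d / 2) *: u)) /=.
rewrite dotDr dotZr u1 uy mulr1 => H.
have : c + d / 2 <= c.
  apply: H; apply: open_simplex_body => //; apply: dQ.
  by rewrite gtr0_norm ?divr_gt0 // ltr_pdivrMr // ltr_pMr // ltr1n.
by apply/negP; rewrite -ltNge ltrDl divr_gt0.
Qed.

Lemma facet_point i : exists y, dot (outward_normal Q i) y = offset Q i /\
  forall j, j != i -> dot (outward_normal Q j) y < offset Q j.
Proof.
pose c (j : 'I_n.+1) : R := (j != i)%:R / n%:R.
have nN0 : n%:R != 0 :> R by rewrite pnatr_eq0 -lt0n.
have c1 : \sum_j c j = 1.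
  rewrite -mulr_suml (bigD1 i) //= eqxx add0r.
  rewrite (eq_bigr (fun=> 1)) => [|j ->//].
  by rewrite sumr_const cardC1 card_ord divff.
have E j := barycentric_normal Q j n0 c1.
exists (\sum_j c j *: Q j); split.
  by apply/esym/eqP; rewrite -subr_eq0 E /c eqxx !mul0r.
move=> j ji; rewrite -subr_gt0 E /c ji mul1r mulr_gt0 ?height_gt0 //.
by rewrite invr_gt0 ltr0n.
Qed.

(** Otherwise some point in the relative interior of the facet avoids every mirror together with a
    ball around it. The ball meets the component, hence lies in it, and [body Q] would contain
    points beyond the facet. *)
Lemma facet_is_mirror i : G (reflection (outward_normal Q i) (offset Q i)).
Proof.
apply: contrapT => nG; have [x Mx QC] := chQ.
set C := connected_component _ _ in QC.
set f := outward_normal Q i in nG *; set a := offset Q i in nG *.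
have f1 : dot f f = 1 by rewrite normal_unit.
have [y0 [fy0 oy0]] := facet_point i.
(* A mirror [dot u y = c] through a point with [dot y y < K] satisfies [|c| <= (1 + K) / 2 <= K], so
   only finitely many mirrors come near [y0]. *)
pose K := dot y0 y0 + 1.
have [l lE] := (finite_seqP _).1 (finitely_many_mirrors K dG G1 GM).
pose U0 := [set y | forall j, j != i -> dot (outward_normal Q j) y < offset Q j]
  `&` [set y : 'rV[R]_n | dot y y < K].
have oU0 : open U0.
  apply: openI; first exact: open_simplex_open.
  apply: (@open_comp _ _ (fun y : 'rV[R]_n => dot y y) [set z | z < K]).
    by move=> y _; apply: cvg_dot; exact: cvg_id.
  exact: open_lt.
have lP (p : 'rV[R]_n * R) : p \in l <-> [/\ dot p.1 p.1 = 1, `|p.2| <= K &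
    G (reflection p.1 p.2)].
  by have := congr1 (fun A => A p) lE => /= ->.
have U0c u c y : U0 y -> dot u u = 1 -> dot u y = c -> `|c| <= K.
  move=> [_ /= yK] u1 <-; have := dot_ge0 (u - y); have := dot_ge0 (u + y).
  have := dot_ge0 y0; rewrite /K in yK *.
  by rewrite !dotE u1 (dotC y u) ler_norml; lra.
have [|p pl|y [fy U0y yl]] := @generic_avoid _ _ l
    (fun p => [set y | [set p.2] (dot p.1 y)]) (hyperplane f a) U0 oU0.
- by exists y0; split => //; split => //=; rewrite /K ltrDl.
- have [p1 pK Gp] := (lP p).1 pl; split.
    by apply: closed_levels; exact: real_set1_closed.
  move=> U' oU' HU'; apply: levels_nowhere_dense => //.
  + by move=> c /= ->; exists 1 => // c' /andP[+ _] E; rewrite E subrr normr0 ltxx.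
  + by move=> [E E']; apply: nG; rewrite -E E'.
  + by move=> [E E']; apply: nG; rewrite -reflectionN -E E'.
pose U1 := U0 `&` \bigcap_(p in [set` l]) ~` [set y | [set p.2] (dot p.1 y)].
have oU1 : open U1.
  apply: openI => //; apply: open_finite_bigcap; first exact: finite_seq.
  by move=> p _; rewrite openC; apply: closed_levels; exact: real_set1_closed.
have U1y : U1 y by split => // p pl; exact: yl.
have U1M : U1 `<=` mirror_complement G.
  move=> z [U0z zl]; apply/mirror_complementP => u c u1 Gu uz.
  apply: (zl (u, c)) => //=; apply/lP; split => //=.
  exact: U0c U0z u1 uz.
have /nbhs_ballP[d /= d0 dU] := open_nbhs_nbhs (conj oU1 U1y).
have By : ball y d y by exact: ballxx.
have cB : connected (ball y d).
  apply: (star_connected By) => z + t /andP[t0 t1].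
  rewrite -ball_normE /= opprD addrA subrr add0r normrN normrZ ger0_norm // distrC.
  by move=> /(le_lt_trans _); apply; rewrite ler_piMl.
have bQy : body Q y.
  apply/bodyP => // j; have [->|ji] := eqVneq j i; first by rewrite -/f fy.
  by apply/ltW; case: U0y => + _; apply.
have BC : ball y d `<=` C.
  have : (C `&` ball y d) !=set0.
    by move: bQy; rewrite QC => /(_ (ball y d)); apply; exact: nbhsx_ballx.
  have cC : connected C by exact: component_connected.
  move=> CB; have cU := connectedU CB cC cB => z Bz; apply: (@connected_component_max _ _ (C `|` ball y d)) => //.
  - by left; exact: connected_component_refl.
  - move=> t [/connected_component_sub //|Bt]; apply: U1M; exact: dU.
  - by right.
have [d' d'0 d'B] := nbhs_line f (nbhsx_ballx y _ d0).
have : body Q (y + (d' / 2) *: f).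
  rewrite QC; apply: subset_closure; apply: BC; apply: d'B.
  by rewrite gtr0_norm ?divr_gt0 // ltr_pdivrMr // ltr_pMr // ltr1n.
move=> /(bodyP _ _ n0) /(_ i); rewrite -/f -/a dotDr dotZr f1 fy mulr1.
by apply/negP; rewrite -ltNge ltrDl divr_gt0.
Qed.

End Chamber.

(** * Folding into the chamber *)

Lemma reflection_conj (R : realType) n (w u : 'rV[R]_n) d c :
  dot w w = 1 ->
  reflection w d \o reflection u c \o reflection w d =
  reflection (u - (2 * dot w u) *: w) (c - 2 * dot w u * d).
Proof.
move=> w1; apply/funext => y /=; rewrite /reflection !dotE w1 (dotC u w).
apply/rowP => i; rewrite !mxE; ring.
Qed.

Definition on_mirror (R : realType) n (G : set ('rV[R]_n -> 'rV[R]_n)) y :=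
  exists u c, [/\ dot u u = 1, G (reflection u c) & dot u y = c].

Lemma progression_gap (R : realType) (a b : R) (k : int) c' : 0 < b ->
  0 < `|c' - (a + b * k%:~R)| < b -> forall l : int, c' <> a + b * l%:~R.
Proof.
move=> b0 + l E; rewrite {}E.
have -> : a + b * l%:~R - (a + b * k%:~R) = b * (l - k)%:~R by rewrite intrB; ring.
rewrite normrM (gtr0_norm b0) pmulr_rgt0 // normr_gt0 intr_eq0 subr_eq0.
rewrite gtr_pMr // -intr_norm -(mulr1z 1) ltr_int => /andP[]; lia.
Qed.

Lemma closed_progression (R : realType) (a b : R) : 0 < b ->
  closed [set c | exists k : int, c = a + b * k%:~R].
Proof.
move=> b0; rewrite -[X in closed X]setCK closedC openE => x /= nx.
pose k := Num.floor ((x - a) / b).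
have [lo hi] : a + b * k%:~R < x /\ x < a + b * (k + 1)%:~R.
  have /andP[k1 k2] : k%:~R <= (x - a) / b < (k + 1)%:~R.
    by rewrite ge_floor floorD1_gt.
  rewrite ler_pdivlMr // in k1; rewrite ltr_pdivrMr // in k2.
  split; last by lra.
  rewrite lt_neqAle; apply/andP; split; last by lra.
  by apply/eqP => E; apply: nx; exists k.
have /near_in_itvoo : x \in `]a + b * k%:~R, a + b * (k + 1)%:~R[ by rewrite in_itv /= lo hi.
apply: filterS => z; rewrite in_itv /= => /andP[z1 z2] [l zl].
move: z1 z2; rewrite zl !ltrD2l !ltr_pM2l // !ltr_int; lia.
Qed.

Definition generic_coords (R : realType) n (x : 'I_n -> R) :=
  (forall i (k : int), x i <> k%:~R) /\
  (forall i j b (k : int), i != j -> x i + (-1) ^+ (b : bool) * x j <> 2 * k%:~R).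

(** Such maps permute the standard hyperplanes; the translations being even is what preserves x_i +-
    x_j = 2k. *)
Lemma generic_coords_signed (R : realType) n (x x' : 'I_n -> R)
    (t : {perm 'I_n}) (b : 'I_n -> bool) (m : 'I_n -> int) :
  (forall i, x' i = (-1) ^+ (b i) * x (t i) + 2 * (m i)%:~R) ->
  generic_coords x -> generic_coords x'.
Proof.
move=> xE [g1 g2].
have sE i : ((-1) ^+ b i : int)%:~R = (-1) ^+ b i :> R by rewrite rmorphXn rmorphN1.
have xE' i : x (t i) = (-1) ^+ (b i) * (x' i - 2 * (m i)%:~R).
  by rewrite xE addrK mulrA -signr_addb addbb expr0 mul1r.
split => [i k E|i j c k ij E].
  apply: (g1 (t i) ((-1) ^+ b i * (k - 2 * m i))).
  by rewrite xE' E !intrM intrB intrM sE.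
have := @g2 (t i) (t j) (c (+) b i (+) b j)
  ((-1) ^+ b i * (k - m i - (-1) ^+ c * m j)).
rewrite (inj_eq perm_inj) => /(_ ij); apply.
rewrite !xE' !signr_addb !intrM !intrB !intrM sE rmorphXn rmorphN1.
have sb : (-1) ^+ b j * (-1) ^+ b j = 1 :> R by rewrite -signr_addb addbb.
transitivity ((-1) ^+ b i * (x' i + (-1) ^+ c * x' j * ((-1) ^+ b j * (-1) ^+ b j)
   - 2 * (m i)%:~R - 2 * (-1) ^+ c * (m j)%:~R * ((-1) ^+ b j * (-1) ^+ b j))).
  by ring.
by rewrite sb !mulr1 E; ring.
Qed.

(** Supplies a natural number that decreases under the reflection in x = 1, however little x exceeds
    1; the folding below terminates by it. *)
Lemma truncn_reflect_lt (R : realType) (a : R) : 1 < a ->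
  (Num.truncn `|2 - a|%R < Num.truncn `|a|%R)%N.
Proof.
move=> a1; rewrite truncn_lt_nat // (gtr0_norm (lt_trans ltr01 a1)).
have : (1 <= Num.truncn a)%N by rewrite truncn_gt0 ltW.
rewrite -(ler_nat R); have := truncnS_gt a; rewrite -natr1.
move: ((Num.truncn a)%:R) => m am m1; rewrite ltr_norml; lra.
Qed.

Section Fold.
Variables (R : realType) (n : nat) (Q : simplex R n) (s : {perm 'I_n.+1}).
Variables (e : nat -> 'rV[R]_n) (v : 'rV[R]_n) (r : R).
Variable G : set ('rV[R]_n -> 'rV[R]_n).
Hypothesis n2 : (2 <= n)%N.
Hypothesis adQ : adapted_frame Q s e v r.
Hypothesis GM : forall g h, G g -> G h -> G (g \o h).
Hypothesis GQ : forall i, G (reflection (outward_normal Q i) (offset Q i)).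

Let n0 : (0 < n)%N. Proof. by lia. Qed.
Let fe : frame e. Proof. by case: adQ. Qed.
Let r0 : 0 < r. Proof. by case: adQ. Qed.

Local Notation x := (crd e v r).
Local Notation GQ' := (simplex_group Q).
Local Notation refl i := (reflection (outward_normal Q i) (offset Q i)).

(** Conjugation by a wall reflection of [Q], itself an element of [G], carries mirrors of [G] to
    mirrors of [G]. *)
Lemma on_mirror_invariant g y : GQ' g -> on_mirror G y <-> on_mirror G (g y).
Proof.
move: y; suff : GQ' `<=` [set g | forall y, on_mirror G y <-> on_mirror G (g y)].
  by move=> H y /H; apply.
apply: generated_group_sub => //.
- move=> h /(facet_reflectionsP Q _ n0) [i ->].
  have w1 := normal_unit Q i n0.
  have K y : on_mirror G y -> on_mirror G (refl i y).
    move=> [u [c [u1 Gu uy]]]; set w := outward_normal Q i; set d := offset Q i.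
    exists (u - (2 * dot w u) *: w), (c - 2 * dot w u * d); split.
    + by rewrite !dotE u1 (dotC u w) w1; ring.
    + rewrite -reflection_conj //; apply: (GM _ (GQ i)); exact: (GM (GQ i) Gu).
    + by rewrite /reflection !dotE -uy (dotC u w) w1; ring.
  by move=> y; split; [exact: K|move/K; rewrite reflectionK].
- by move=> g' h Hg Hh y; rewrite Hh; exact: Hg.
- by move=> g' h Hg gh hg y; rewrite (Hg (h y)) hg.
Qed.

Let GQ1 : GQ' id. Proof. exact: generated_id. Qed.
Let GQM g h : GQ' g -> GQ' h -> GQ' (g \o h).
Proof. exact: generated_comp. Qed.
Let GQr i : GQ' (refl i).
Proof. by apply: generated_gen; apply/facet_reflectionsP => //; exists i. Qed.

Let size y : nat := (\sum_(i < n) Num.truncn `|x i.+1 y|)%N.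
Let height_sum y : R := \sum_(i < n) i.+1%:R * x i.+1 y.

(* [size] decreases under the reflection in [x_n = 1] as long as [x_n > 1]; on
   the finite set of signed permutations of a point of minimal [size],
   [height_sum] is maximal at the sorted nonnegative one. *)
Lemma fold_chain y : exists2 g, GQ' g &
  forall k, (k <= n)%N -> x k (g y) <= x k.+1 (g y) + (k == n)%:R.
Proof.
have ex : exists k, `[< exists2 g, GQ' g & size (g y) = k >].
  by exists (size y); apply/asboolP; exists id.
case: (ex_minnP ex) => N /asboolP[g1 Gg1 N1] minN; set y1 := g1 y in N1.
pose T := ({perm 'I_n} * {ffun 'I_n -> bool})%type.
pose rel_ (p : T) g := forall i : 'I_n, x i.+1 (g y1) = (-1) ^+ (p.2 i) * x (p.1 i).+1 y1.
pose ok (p : T) : bool := `[< exists2 g, GQ' g & rel_ p g >].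
pose F (p : T) : R := \sum_(i < n) i.+1%:R * ((-1) ^+ (p.2 i) * x (p.1 i).+1 y1).
have ok0 : ok (1%g, [ffun=> false]).
  apply/asboolP; exists id => // i /=.
  by rewrite ffunE perm1 expr0 mul1r.
have [p /asboolP[g2 Gg2 rg2] pmax] := @arg_maxP _ _ _ _ ok F ok0.
set y2 := g2 y1 in rg2.
have hmax g (q : T) : GQ' g -> rel_ q (g \o g2) -> height_sum (g y2) <= height_sum y2.
  move=> Gg rq; have -> : height_sum (g y2) = F q.
    by apply: eq_bigr => i _; rewrite -rq.
  have -> : height_sum y2 = F p by apply: eq_bigr => i _; rewrite -rg2.
  by apply: pmax; apply/asboolP; exists (g \o g2) => //; exact: GQM.
(* Signed permutations keep the absolute values of the coordinates, so [y2] still has minimal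
   [size]. *)
have sizeE : size y2 = N.
  rewrite -N1 /size [RHS](reindex_inj (@perm_inj _ p.1)) /=.
  by apply: eq_bigr => i _; rewrite rg2 normrM normr_sign mul1r.
exists (g2 \o g1); first exact: GQM.
rewrite /= -/y1 -/y2 => k kn.
pose j := (s^-1)%g (inord k); have sj : s j = k :> nat by rewrite permKV inordK.
have [k0|k0] := eqVneq k 0%N.
  (* Changing the sign of x_1 changes [height_sum] by - 2 x_1, so maximality gives 0 <= x_1. *)
  rewrite k0 crd0 //; have -> : (0 == n)%N = false by lia.
  rewrite addr0; rewrite k0 in sj.
  have := hmax (refl j) (p.1, [ffun i => p.2 i (+) (i == 0 :> nat)]) (GQr j).
  have rE i := adapted_reflection0 n2 adQ y2 i sj.
  have H : rel_ (p.1, [ffun i => p.2 i (+) (i == 0 :> nat)]) (refl j \o g2).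
    by move=> i /=; rewrite rE -/y2 rg2 ffunE signr_addb; ring.
  move=> /(_ H); rewrite /height_sum [leLHS](bigD1 (Ordinal n0)) //= [leRHS](bigD1 (Ordinal n0)) //=.
  rewrite (rE (Ordinal n0)) /= expr1.
  rewrite (eq_bigr (fun i : 'I_n => i.+1%:R * x i.+1 y2)); first by rewrite !mul1r; lra.
  move=> i i0; rewrite rE; have -> : (i == 0%N :> nat) = false by apply: negPf.
  by rewrite expr0 mul1r.
have [kn'|kn'] := eqVneq k n.
  rewrite kn' crdSn // add0r leNgt; apply/negP => x1.
  rewrite kn' in sj; have rE i := adapted_reflectionn n2 adQ y2 i sj.
  have ln : (n.-1 < n)%N by lia.
  have : (N <= size (refl j y2))%N.
    apply: minN; apply/asboolP; exists (refl j \o g2 \o g1) => //.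
    by apply: GQM => //; exact: GQM.
  rewrite -sizeE /size [leqLHS](bigD1 (Ordinal ln)) //= [leqRHS](bigD1 (Ordinal ln)) //=.
  rewrite (rE (Ordinal ln)) /= prednK //.
  rewrite eqxx expr1 [in leqRHS](eq_bigr (fun i : 'I_n => Num.truncn `|x i.+1 y2|)); last first.
    move=> i il; rewrite rE; have -> : (i.+1 == n) = false.
      apply/eqP => E; move/eqP: il; apply; apply: val_inj => /=; lia.
    by rewrite expr0 mul1r mulr0 addr0.
  rewrite leq_add2r leqNgt => /negP; apply.
  rewrite mulN1r mulr1 addrC distrC.
  by have := truncn_reflect_lt x1; rewrite distrC (gtr0_norm (lt_trans ltr01 x1)).
rewrite addr0.
(* The weights being consecutive, swapping x_k and x_(k+1) changes [height_sum] by x_k - x_(k+1). *)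
have an : (k.-1 < n)%N by lia.
have bn : (k < n)%N by lia.
pose a := Ordinal an; pose b := Ordinal bn.
have sa : s j = a.+1 :> nat by rewrite sj /=; lia.
have sb : s j = b :> nat by rewrite sj.
have rE i := adapted_reflection_mid n2 adQ y2 i sa sb.
have := hmax (refl j) ((tperm a b * p.1)%g, [ffun i => p.2 (tperm a b i)]) (GQr j).
have H : rel_ ((tperm a b * p.1)%g, [ffun i => p.2 (tperm a b i)]) (refl j \o g2).
  by move=> i /=; rewrite rE -/y2 rg2 ffunE permM.
have ba : b != a by apply/eqP => /(congr1 val) /=; lia.
move=> /(_ H); rewrite /height_sum [leLHS](bigD1 a) //= [leRHS](bigD1 a) //=.
rewrite [in leLHS](bigD1 b) //= [in leRHS](bigD1 b) //=.
rewrite (rE a) (rE b) tpermL tpermR /= (eq_bigr (fun i : 'I_n => i.+1%:R * x i.+1 y2)).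
  rewrite prednK ?lt0n // -(natr1 k).
  move: (x k y2) (x k.+1 y2) (k%:R : R) (\sum_(_ < n | _) _) => X Y K S; nra.
by move=> i /andP[ia ib]; rewrite rE tpermD // eq_sym.
Qed.

(** Genericity survives folding, and equality in one of the inequalities of [fold_chain] would put
    the folded point on a standard hyperplane. *)
Lemma fold_inside y : generic_coords (fun i : 'I_n => x i.+1 y) ->
  exists2 g, GQ' g & open_simplex Q (g y).
Proof.
move=> gy; have [g Gg H] := fold_chain y; exists g => //.
apply/(insideP adQ) => k kn; rewrite lt_neqAle H // andbT.
have [t [b [m gE]]] := simplex_group_signed n2 adQ Gg.
have [g1 g2] := generic_coords_signed (gE y) gy.
apply/eqP; have [->|k0] := eqVneq k 0%N.
  have -> : (0 == n)%N = false by lia.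
  rewrite crd0 // addr0 => E; apply: (g1 (Ordinal n0) 0) => /=.
  by rewrite -E.
have kE : k.-1.+1 = k by lia.
have an : (k.-1 < n)%N by lia.
have [kn'|kn'] := eqVneq k n.
  rewrite kn' crdSn // add0r => E; apply: (g1 (Ordinal an) 1) => /=.
  by rewrite kE kn' E.
have bn : (k < n)%N by lia.
rewrite addr0 => E; apply: (g2 (Ordinal an) (Ordinal bn) true 0).
  by apply/eqP => /(congr1 val) /=; lia.
by rewrite /= kE E expr1; ring.
Qed.

(* [u] and [c] describe the hyperplane [x_i = k] or [x_i +- x_j = 2k]. *)
Definition short_mirror (u : 'rV[R]_n) (c : R) (i : 'I_n) (k : int) :=
  exists b : bool, u = (-1) ^+ b *: e i.+1 /\
    c = (-1) ^+ b * (dot (e i.+1) v + r * k%:~R).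

Definition long_mirror (u : 'rV[R]_n) (c : R) (i j : 'I_n) (d : bool) (k : int) :=
  exists b : bool,
    u = ((-1) ^+ b / Num.sqrt 2) *: (e i.+1 + (-1) ^+ d *: e j.+1) /\
    c = (-1) ^+ b / Num.sqrt 2 *
        (dot (e i.+1 + (-1) ^+ d *: e j.+1) v + r * (2 * k%:~R)).

Hypothesis no_mirror : forall u c y, dot u u = 1 -> G (reflection u c) ->
  open_simplex Q y -> dot u y <> c.

(** The standard hyperplanes are infinite in number but have finitely many directions, and in each
    direction their levels form a closed arithmetic progression; hence [generic_avoid] finds a point
    of a non-standard mirror off all of them, to which folding applies. *)
Lemma mirror_classification u c : dot u u = 1 -> G (reflection u c) ->
  (exists i k, short_mirror u c i k) \/
  (exists i j d k, i != j /\ long_mirror u c i j d k).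
Proof.
move=> u1 Gu; apply: contrapT => nstd.
pose h : R := (Num.sqrt 2)^-1.
have h0 : 0 < h by rewrite invr_gt0 sqrtr_gt0.
have hh : h ^+ 2 = 2^-1 by rewrite exprVn sqr_sqrtr.
(* [inl i] stands for the hyperplanes x_i = k, with levels spaced by [r]; [inr (i, j, d)] for x_i +-
   x_j = 2k, with unit normal [w] and levels spaced by 2 r / sqrt 2. *)
pose J := ('I_n + 'I_n * 'I_n * bool)%type.
pose w (q : J) : 'rV[R]_n := match q with
  | inl i => e i.+1
  | inr (i, j, d) => h *: (e i.+1 + (-1) ^+ d *: e j.+1) end.
pose bt (q : J) : R := match q with inl _ => r | inr _ => h * r * 2 end.
pose ok (q : J) : bool := match q with inl _ => true | inr (i, j, _) => i != j end.
pose D (q : J) : set R := [set z | exists k : int, z = dot (w q) v + bt q * k%:~R].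
have bt0 q : 0 < bt q by case: q => [i|p] //=; rewrite !mulr_gt0.
have w1 q : ok q -> dot (w q) (w q) = 1.
  case: q => [i|[[i j] d]] /= ij; first by rewrite frame_dot // eqxx.
  rewrite !dotE !frame_dot // !eqxx (eq_sym j) (negPf ij) /=.
  rewrite -(signr_odd R d); case: (odd d); rewrite ?expr1 ?expr0.
    by transitivity (h ^+ 2 * 2); [ring|rewrite hh mulVf].
  by transitivity (h ^+ 2 * 2); [ring|rewrite hh mulVf].
have [|||y [uy _ yD]] := @generic_avoid _ _ [seq q <- enum {: J} | ok q]
    (fun q => [set y | D q (dot (w q) y)]) (hyperplane u c) setT.
- exact: openT.
- by exists (c *: u); split => //; rewrite /hyperplane /= dotZr u1 mulr1.
- move=> q; rewrite mem_filter => /andP[okq _]; split.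
    by apply: closed_levels; exact: closed_progression.
  apply: levels_nowhere_dense => //; first exact: w1.
  + move=> z [k ->]; exists (bt q) => // z' /(progression_gap (bt0 q)) H [l].
    exact: H.
  + move=> [wu [k ck]]; apply: nstd; case: q okq wu ck => [i|[[i j] d]] /= ij wu ck.
      left; exists i, k, false; rewrite expr0 scale1r mul1r; split => //.
    right; exists i, j, d, k; split => //; exists false.
    by rewrite expr0 mul1r -/h -wu; split => //; rewrite ck dotZl; ring.
  + move=> [wu [k ck]]; apply: nstd; case: q okq wu ck => [i|[[i j] d]] /= ij wu ck.
      left; exists i, k, true; rewrite expr1 scaleN1r mulN1r wu opprK; split => //.
      by rewrite -wu -ck opprK.
    right; exists i, j, d, k; split => //; exists true.
    rewrite expr1 mulN1r -/h scaleNr wu opprK; split => //.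
    by rewrite -[c]opprK ck dotZl; ring.
have : generic_coords (fun i : 'I_n => x i.+1 y).
  split => [i k xk|i j d k ij xk].
    apply: (yD (inl i)); first by rewrite mem_filter mem_enum.
    exists k => /=; rewrite -xk /crd mulrC divfK ?gt_eqF // dotBr; ring.
  apply: (yD (inr (i, j, d))); first by rewrite mem_filter mem_enum /= ij.
  exists k => /=; transitivity (h * (dot (e i.+1 + (-1) ^+ d *: e j.+1) v
     + r * (2 * k%:~R))); last by rewrite dotZl; ring.
  rewrite -xk /crd dotZl !dotE; congr (_ * _); field.
  by rewrite gt_eqF.
move=> /fold_inside [g Gg Qgy].
have /(on_mirror_invariant _ Gg) [u' [c' [u1' Gu' E]]] : on_mirror G y by exists u, c.
exact: no_mirror u1' Gu' Qgy E.
Qed.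

End Fold.

(** * Generating simplices are Coxeter simplices *)

Lemma sign_sqr (R : realType) (b : bool) : (-1) ^+ b * (-1) ^+ b = 1 :> R.
Proof. by rewrite -signr_addb addbb. Qed.

Lemma short_mirror_reflection (R : realType) n (e : nat -> 'rV[R]_n) v r u c
    i k y (l : 'I_n) : frame e -> 0 < r -> short_mirror e v r u c i k ->
  crd e v r l.+1 (reflection u c y) =
  crd e v r l.+1 y - 2 * (crd e v r i.+1 y - k%:~R) * (l == i)%:R.
Proof.
move=> fe r0 [b [-> ->]]; rewrite crd_reflection dotZr frame_dot // dotZl.
have rN0 : r != 0 by rewrite gt_eqF.
transitivity (crd e v r l.+1 y - 2 * (dot (e i.+1) (y - v) / r - k%:~R) *
   (l == i)%:R * ((-1) ^+ b * (-1) ^+ b)); last by rewrite sign_sqr mulr1.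
by rewrite dotBr; field.
Qed.

Lemma long_mirror_reflection (R : realType) n (e : nat -> 'rV[R]_n) v r u c
    i j d k y (l : 'I_n) : frame e -> 0 < r -> long_mirror e v r u c i j d k ->
  crd e v r l.+1 (reflection u c y) = crd e v r l.+1 y -
  (crd e v r i.+1 y + (-1) ^+ d * crd e v r j.+1 y - 2 * k%:~R) *
  ((l == i)%:R + (-1) ^+ d * (l == j)%:R).
Proof.
move=> fe r0 [b [-> ->]]; rewrite crd_reflection !dotE !frame_dot //.
have rN0 : r != 0 by rewrite gt_eqF.
have s0 : Num.sqrt 2 != 0 :> R by rewrite gt_eqF // sqrtr_gt0.
have s2 : Num.sqrt 2 ^+ 2 = 2 :> R by rewrite sqr_sqrtr.
transitivity (crd e v r l.+1 y -
  (dot (e i.+1) (y - v) / r + (-1) ^+ d * (dot (e j.+1) (y - v) / r) - 2 * k%:~R) *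
  ((l == i)%:R + (-1) ^+ d * (l == j)%:R) * ((-1) ^+ b * (-1) ^+ b) *
  (2 / Num.sqrt 2 ^+ 2)).
  rewrite !dotBr; move: s0; move: (Num.sqrt 2) => h h0; field.
  by rewrite rN0 h0.
by rewrite sign_sqr s2 divff ?mulr1.
Qed.

Lemma sum_delta (n : nat) (i : 'I_n) : \sum_(l < n) (l == i)%:R = 1 :> int.
Proof. by rewrite (bigD1 i) //= eqxx big1 ?addr0 // => j /negPf ->. Qed.

(* Invariant under all standard reflections, except those in [x_i = k] with [k]
   of the parity of [1 - t]. *)
Definition parity_class (R : realType) n (e : nat -> 'rV[R]_n) v r (t : bool) y :=
  exists m : 'I_n -> int,
    (forall i : 'I_n, crd e v r i.+1 y = t%:R + 2 * (m i)%:~R) /\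
    exists q : int, \sum_i m i = 2 * q.

(** The reflection in x_i = t + 2q changes the sum of [m] by 2 (q - m i); a level of the other
    parity would change it by an odd number. *)
Lemma parity_class_short (R : realType) n (e : nat -> 'rV[R]_n) v r (t : bool)
    u c i q y :
  frame e -> 0 < r -> short_mirror e v r u c i (t%:Z + 2 * q) ->
  parity_class e v r t y -> parity_class e v r t (reflection u c y).
Proof.
move=> fe r0 su [m [xm [p mp]]].
exists (fun l => m l - (2 * m i - 2 * q) * (l == i)%:R); split.
  move=> l; rewrite (short_mirror_reflection _ _ fe r0 su) !xm.
  have -> : (t%:Z + 2 * q)%:~R = t%:R + 2 * q%:~R :> R.
    by rewrite intrD intrM; case: t {su xm}.
  rewrite intrB !intrM intrB !intrM.
  have -> : ((l == i)%:R : int)%:~R = (l == i)%:R :> R by case: (l == i).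
  by ring.
exists (p - m i + q); rewrite sumrB -mulr_sumr sum_delta mp; ring.
Qed.

Lemma parity_class_long (R : realType) n (e : nat -> 'rV[R]_n) v r t u c i j d k y :
  frame e -> 0 < r -> long_mirror e v r u c i j d k ->
  parity_class e v r t y -> parity_class e v r t (reflection u c y).
Proof.
move=> fe r0 su [m [xm [p mp]]].
(* [h] is half of x_i +- x_j - 2k. For the plus sign it is subtracted from both entries of [m], for
   the minus sign it is moved from one to the other: the sum changes by - 2 h or not at all. *)
pose h := (if d then 0 else t%:Z) + m i + (-1) ^+ d * m j - k.
exists (fun l => m l - h * ((l == i)%:R + (-1) ^+ d * (l == j)%:R)); split.
  move=> l; rewrite (long_mirror_reflection _ _ fe r0 su) !xm /h.
  rewrite !(intrB, intrD, intrM).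
  have -> : ((l == i)%:R : int)%:~R = (l == i)%:R :> R by case: (l == i).
  have -> : ((l == j)%:R : int)%:~R = (l == j)%:R :> R by case: (l == j).
  by case: d {su h}; case: t {xm}; rewrite /= ?expr1 ?expr0 ?intrN; ring.
exists (p - if d then 0 else h).
rewrite sumrB -mulr_sumr big_split /= -mulr_sumr !sum_delta mp.
by clearbody h; case: d {su} => /=; rewrite ?expr1 ?expr0; ring.
Qed.

Definition standard_mirror (R : realType) n (e : nat -> 'rV[R]_n) v r u c :=
  (exists i k, short_mirror e v r u c i k) \/
  (exists i j d k, i != j /\ long_mirror e v r u c i j d k).

Section Generating.
Variables (R : realType) (n : nat) (P Q : simplex R n) (s : {perm 'I_n.+1}).
Variables (e : nat -> 'rV[R]_n) (v : 'rV[R]_n) (r : R).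
Hypothesis n2 : (2 <= n)%N.
Hypothesis adQ : adapted_frame Q s e v r.
Hypothesis GQ : forall i, simplex_group P (reflection (outward_normal Q i) (offset Q i)).
Hypothesis stdP : forall f, standard_mirror e v r (outward_normal P f) (offset P f).

Let n0 : (0 < n)%N. Proof. by lia. Qed.
Let fe : frame e. Proof. by case: adQ. Qed.
Let r0 : 0 < r. Proof. by case: adQ. Qed.

Local Notation x := (crd e v r).

(** Without such a facet every generator preserves [parity_class]. But the group contains a wall
    reflection of [Q], in x_1 = 0 for [t] true and in x_n = 1 for [t] false, which moves the point
    with all coordinates t to one where [m] has sum -1 or 1. *)
Lemma short_facet_of_parity (t : bool) : exists f i q,
  short_mirror e v r (outward_normal P f) (offset P f) i ((~~ t)%:Z + 2 * q).
Proof.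
apply: contrapT => H.
pose pc := parity_class e v r t.
have gen f y : pc y -> pc (reflection (outward_normal P f) (offset P f) y).
  case: (stdP f) => [[i [k su]]|[i [j [d [k [_ su]]]]]]; last exact: parity_class_long su.
  have [kt|kt] : (exists q, k = t%:Z + 2 * q) \/ (exists q, k = (~~ t)%:Z + 2 * q).
    have : exists q, k = 2 * q \/ k = 1 + 2 * q by exists (k %/ 2)%Z; lia.
    by move=> [q]; case: (t) => -[->|->]; [right|left|left|right]; exists q => /=; ring.
  - by have [q kq] := kt; rewrite kq in su; exact: parity_class_short su.
  - by have [q kq] := kt; exfalso; apply: H; exists f, i, q; rewrite -kq.
have inv : simplex_group P `<=` [set g | forall y, pc y <-> pc (g y)].
  apply: generated_group_sub => //.
  - move=> g /(facet_reflectionsP P _ n0) [f ->] y; split; first exact: gen.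
    by move=> /(gen f); rewrite reflectionK // normal_unit.
  - by move=> g h Hg Hh y; rewrite (Hh y); exact: Hg.
  - by move=> g h Hg gh hg y; rewrite (Hg (h y)) hg.
pose y0 := frame_point e v r (fun=> t%:R).
have xy0 (i : 'I_n) : x i.+1 y0 = t%:R by rewrite crd_frame_point.
have y0c : pc y0.
  exists (fun=> 0); split => [i|]; first by rewrite xy0 mulr0 addr0.
  by exists 0; rewrite sumr_const mul0rn mulr0.
pose j := (s^-1)%g (if t then ord0 else ord_max).
have sj : s j = (if t then 0%N else n) :> nat by rewrite permKV; case: (t).
have [m [xm [q mq]]] := (inv _ (GQ j) y0).1 y0c.
have ln : (n.-1 < n)%N by lia.
pose l0 : 'I_n := if t then Ordinal n0 else Ordinal ln.
have mE l : m l = (-1) ^+ t * (l == l0)%:R.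
  apply/eqP; rewrite -(eqr_int R); apply/eqP.
  have := xm l; rewrite /l0; case: (t) sj xy0 => sj xy0.
    rewrite (adapted_reflection0 n2 adQ) // xy0 -val_eqE /=.
    by case: (l == 0 :> nat); rewrite /= ?expr1 ?expr0 ?mulr1 ?mulr0 ?intrN; lra.
  rewrite (adapted_reflectionn n2 adQ) // xy0 -val_eqE /=.
  have -> : (l.+1 == n) = (l == n.-1 :> nat) by lia.
  by case: (l == n.-1 :> nat); rewrite /= ?expr1 ?expr0 ?mulr1 ?mulr0; lra.
move: mq; rewrite (eq_bigr _ (fun l _ => mE l)) -mulr_sumr sum_delta mulr1.
by case: (t); rewrite ?expr1 ?expr0; lia.
Qed.

Lemma short_mirror_inj u c i k i' k' : short_mirror e v r u c i k ->
  short_mirror e v r u c i' k' -> i = i' /\ k = k'.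
Proof.
move=> [b [ub cb]] [b' [ub' cb']].
have E : (-1) ^+ b * (i' == i)%:R = (-1) ^+ b' :> R.
  have := congr1 (dot (e i'.+1)) (etrans (esym ub) ub').
  by rewrite !dotZr !frame_dot // eqxx mulr1.
have ii : i' = i.
  apply/eqP; apply: contraT => /negPf ni; move: E; rewrite ni mulr0 => /esym/eqP.
  by rewrite signr_eq0.
split => //; rewrite ii eqxx mulr1 in E; move: cb'; rewrite cb ii -E.
move=> /mulfI; rewrite signr_eq0 => /(_ isT) /addrI /mulfI.
by rewrite (gt_eqF r0) => /(_ isT) /intr_inj.
Qed.

(** The factor is 1 or sqrt 2 according to the kind of hyperplane; at the end these factors turn out
    to be the root lengths. *)
Lemma standard_row u c : standard_mirror e v r u c -> exists2 k : R, 0 < k &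
  (forall l : 'I_n, k * dot u (e l.+1) != 0 ->
     k * dot u (e l.+1) = 1 \/ k * dot u (e l.+1) = -1) /\
  exists i j : 'I_n, forall l : 'I_n, k * dot u (e l.+1) != 0 -> l = i \/ l = j.
Proof.
have sg (b : bool) : (-1) ^+ b = 1 \/ (-1) ^+ b = -1 :> R.
  by case: b; rewrite ?expr0 ?expr1; [right|left].
move=> [[i [k [b [-> _]]]]|[i [j [d [k [ij [b [-> _]]]]]]]].
  exists 1; first exact: ltr01.
  have E (l : 'I_n) : 1 * dot ((-1) ^+ b *: e i.+1) (e l.+1) = (-1) ^+ b * (i == l)%:R.
    by rewrite mul1r dotZl frame_dot.
  split; last exists i, i; move=> l; rewrite E; have [il|il] := eqVneq i l.
  - by rewrite mulr1 => _; exact: sg.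
  - by rewrite mulr0 eqxx.
  - by left; exact: esym.
  - by rewrite mulr0 eqxx.
have s0 : 0 < Num.sqrt 2 :> R by rewrite sqrtr_gt0.
exists (Num.sqrt 2) => //.
have E (l : 'I_n) : Num.sqrt 2 * dot (((-1) ^+ b / Num.sqrt 2) *:
    (e i.+1 + (-1) ^+ d *: e j.+1)) (e l.+1) =
    (-1) ^+ b * ((i == l)%:R + (-1) ^+ d * (j == l)%:R).
  rewrite !dotE !frame_dot // mulrA; congr (_ * _).
  by rewrite mulrC divfK // gt_eqF.
split; last exists i, j; move=> l; rewrite E.
- have [il|il] := eqVneq i l.
    by rewrite -il (eq_sym j i) (negPf ij) mulr0 addr0 mulr1 => _; exact: sg.
  rewrite add0r; have [_|_] := eqVneq j l; last by rewrite !mulr0 eqxx.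
  by rewrite mulr1 -signr_addb => _; exact: sg.
- have [->|_] := eqVneq l i; first by left.
  have [->|_] := eqVneq l j; first by right.
  by rewrite mulr0 addr0 mulr0 eqxx.
Qed.

Lemma frame_parseval (a b : 'rV[R]_n) :
  dot a b = \sum_(l < n) dot a (e l.+1) * dot b (e l.+1).
Proof.
rewrite {1}(frame_expand b fe) dot_sumr; apply: eq_bigr => l _.
by rewrite dotZr mulrC (dotC b).
Qed.

Lemma generating_coxeter : coxeter_C_tilde P.
Proof.
have HK f : exists k : R, 0 < k /\
    (forall l : 'I_n, k * dot (outward_normal P f) (e l.+1) != 0 ->
     k * dot (outward_normal P f) (e l.+1) = 1 \/
     k * dot (outward_normal P f) (e l.+1) = -1) /\
    exists i j : 'I_n, forall l : 'I_n, k * dot (outward_normal P f) (e l.+1) != 0 ->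
      l = i \/ l = j.
  by have [k k0 H] := standard_row (stdP f); exists k.
have [k kP] := choice HK.
have k0 f : 0 < k f by have [] := kP f.
pose al f (l : 'I_n) : R := k f * dot (outward_normal P f) (e l.+1).
have [f0 [i0 [q0 s0]]] := short_facet_of_parity true.
have [f1 [i1 [q1 s1]]] := short_facet_of_parity false.
have f01 : f0 != f1.
  apply/eqP => E; rewrite -E in s1.
  by have [_] := short_mirror_inj s0 s1; rewrite /=; lia.
have short1 f i q : short_mirror e v r (outward_normal P f) (offset P f) i q ->
    #|[set l | al f l != 0]%SET| = 1%N.
  move=> [b [E _]].
  have -> : [set l | al f l != 0]%SET = [set i]%SET; last exact: cards1.
  apply/setP => l; rewrite !inE /al E dotZl frame_dot //.
  rewrite !mulf_eq0 signr_eq0 gt_eqF //=.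
  by rewrite pnatr_eq0 eqb0 negbK eq_sym.
(* Row [f] is the normal scaled by [k f], so its coefficient in the relation is divided by [k f]. *)
have [|||||||||s' s'E] := @chain_of_counting R n al
    (fun f => (height P f)^-1 / k f) f0 f1 n2.
- by move=> f l; have [_ [+ _]] := kP f; apply.
- by move=> f; rewrite divr_gt0 // invr_gt0 height_gt0.
- move=> l; transitivity (dot (\sum_f (height P f)^-1 *: outward_normal P f) (e l.+1)).
    rewrite dot_suml; apply: eq_bigr => f _; rewrite dotZl /al mulrA divfK //.
    by rewrite gt_eqF.
  by rewrite normal_relation // dot0l.
- move=> nu nuE.
  have E : \sum_f (nu f * k f) *: outward_normal P f = 0.
    rewrite (frame_expand (\sum_f _) fe) big1 // => l _.
    rewrite dot_sumr (eq_bigr (fun f => nu f * al f l)) ?nuE ?scale0r // => f _.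
    by rewrite dotZr dotC /al mulrA.
  have [K KE] := normal_relation_uniq n0 E; exists K => f.
  by rewrite mulrA -KE mulfK // gt_eqF.
- move=> l; apply: contrapT => H.
  have : e l.+1 = 0.
    apply: (normal_span (P := P)) => // f; apply: contrapT => /eqP Hf.
    by apply: H; exists f; rewrite /al mulf_neq0 // gt_eqF.
  move=> /(congr1 (dot (e l.+1))); rewrite frame_dot // eqxx dot0r => /eqP.
  by rewrite oner_eq0.
- move=> f; have [_ [_ [i [j ij]]]] := kP f.
  apply: leq_trans (subset_leq_card (_ : _ \subset [set i; j]%SET)) _.
    by apply/fintype.subsetP => l; rewrite !inE => /ij[] ->; rewrite eqxx ?orbT.
  by rewrite cards2; case: (i != j).
- exact: f01.
- exact: short1 s0.
- exact: short1 s1.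
apply/coxeter_C_tildeP => //; exists s'.
have dE f g : dot (k f *: outward_normal P f) (k g *: outward_normal P g) =
    chain_gram R n (s' f) (s' g).
  rewrite -s'E frame_parseval; apply: eq_bigr => l _.
  by rewrite !dotZl.
(* The normals have length 1, so the diagonal of the Gram matrix determines the positive factors. *)
have kE f : k f = root_len R n (s' f).
  apply: (@pexpIrn _ 2) => //; rewrite ?nnegrE ?ltW // ?root_len_gt0 //.
  have sn : (s' f <= n)%N by rewrite -ltnS.
  rewrite root_len_sqr // -dE dotZl dotZr normal_unit // mulr1.
  by rewrite expr2.
by move=> f g; rewrite -!kE.
Qed.

End Generating.

Lemma generates_coxeter (R : realType) n (P : simplex R n) : (2 <= n)%N ->
  generates_C_tilde P -> coxeter_C_tilde P.
Proof.
move=> n2 [dG [Q cQ chQ]]; have n0 : (0 < n)%N by lia.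
have [s [e [v [r ad]]]] := adapted_frame_exists n2 cQ.
have G1 : simplex_group P id by exact: generated_id.
have GM g h : simplex_group P g -> simplex_group P h -> simplex_group P (g \o h).
  exact: generated_comp.
have GQ i := facet_is_mirror n0 dG G1 GM chQ i.
apply: (generating_coxeter n2 ad GQ) => f.
apply: (mirror_classification n2 ad GM GQ) => [u c y||].
- exact: no_mirror_inside n0 chQ u c y.
- exact: normal_unit.
- by apply: generated_gen; apply/facet_reflectionsP => //; exists f.
Qed.

(** * Families *)

(** There are at least three facets, and two parallel normals would give a nonzero relation
    vanishing at a third. *)
Lemma normals_not_parallel (R : realType) n (P : simplex R n) (b : bool) i j :
  (2 <= n)%N -> outward_normal P i = (-1) ^+ b *: outward_normal P j -> i = j.
Proof.
move=> n2 E; have n0 : (0 < n)%N by lia.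
apply: contrapT => /eqP ij.
have [k [ki kj]] : exists k, k != i /\ k != j.
  apply: contrapT => H.
  have := @uniq_leq_card _ [set i; j]%SET (enum 'I_n.+1) (enum_uniq _).
  rewrite cards2 ij size_enum_ord => K; suff : (n.+1 <= 2)%N by lia.
  apply: K => y _; rewrite !inE; apply: contraT; rewrite negb_or => /andP[yi yj].
  by exfalso; apply: H; exists y.
pose nu l : R := (l == i)%:R - (-1) ^+ b * (l == j)%:R.
have [|K KE] := @normal_relation_uniq R n P nu n0.
  rewrite (bigD1 i) //= (bigD1 j) 1?eq_sym //= big1 ?addr0.
    rewrite /nu !eqxx (negPf ij) (eq_sym j) (negPf ij) mulr0 subr0 scale1r mulr1.
    by rewrite sub0r scaleNr E subrr.
  by move=> l /andP[/negPf li /negPf lj]; rewrite /nu li lj mulr0 subr0 scale0r.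
have h l : (height P l)^-1 != 0 by rewrite invr_eq0 gt_eqF // height_gt0.
have K0 : K = 0.
  apply/eqP; have := KE k; rewrite /nu (negPf ki) (negPf kj) mulr0 subr0 => /esym/eqP.
  by rewrite mulf_eq0 (negPf (h k)) orbF.
have := KE i; rewrite /nu eqxx (negPf ij) mulr0 subr0 K0 mul0r => /eqP.
by rewrite oner_eq0.
Qed.

(** The relation of [Q], rewritten in the normals of [P], has coefficients of the form sign times
    positive number and is a multiple of the positive relation of [P]. So all signs agree, and the
    Gram matrix of the normals changes only by relabelling. *)
Lemma family_coxeter (R : realType) n (P Q : simplex R n) : (2 <= n)%N ->
  facet_normals Q = facet_normals P -> coxeter_C_tilde P -> coxeter_C_tilde Q.
Proof.
move=> n2 E cP; have n0 : (0 < n)%N by lia.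
have HN i : exists p : 'I_n.+1 * bool,
    outward_normal Q i = (-1) ^+ p.2 *: outward_normal P p.1.
  have : facet_normals Q (outward_normal Q i) by exists i; left.
  rewrite E => -[j [->|->]]; [exists (j, false)|exists (j, true)].
    by rewrite expr0 scale1r.
  by rewrite expr1 scaleN1r.
have [p pE] := choice HN.
have pinj : injective (fun i => (p i).1).
  move=> i j ij; apply: (@normals_not_parallel R n Q ((p i).2 (+) (p j).2)) => //.
  by rewrite !pE scalerA ij signr_addb -mulrA -signr_addb addbb mulr1.
pose t := perm pinj; have tE i : t i = (p i).1 by rewrite permE.
have [|K KE] := @normal_relation_uniq R n P
    (fun j => (-1) ^+ (p ((t^-1)%g j)).2 / height Q ((t^-1)%g j)) n0.
  rewrite -[RHS](normal_relation Q n0) (reindex_inj (@perm_inj _ t)) /=.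
  by apply: eq_bigr => i _; rewrite permK pE -tE scalerA mulrC.
have sgn i j : (-1) ^+ (p i).2 * (-1) ^+ (p j).2 = 1 :> R.
  have S k : (-1) ^+ (p k).2 = K * (height Q k / height P (t k)).
    have := KE (t k); rewrite permK => /(congr1 (fun z => z * height Q k)).
    rewrite divfK ?gt_eqF ?height_gt0 // => ->.
    by rewrite mulrAC mulrA.
  have pos k : 0 < height Q k / height P (t k) by rewrite divr_gt0 ?height_gt0.
  have : 0 <= (-1) ^+ (p i).2 * (-1) ^+ (p j).2 :> R.
    rewrite !S mulrACA mulr_ge0 //; first by rewrite -expr2 sqr_ge0.
    by rewrite mulr_ge0 // ltW.
  by rewrite -signr_addb; case: (_ (+) _); rewrite ?expr1 // ler0N1.
have [s sE] := (coxeter_C_tildeP P n2).1 cP.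
apply/coxeter_C_tildeP => //; exists (t * s)%g => i j.
rewrite !permM -sE !pE -!tE !dotE.
transitivity (root_len R n (s (t i)) * (root_len R n (s (t j)) *
  dot (outward_normal P (t i)) (outward_normal P (t j))) *
  ((-1) ^+ (p i).2 * (-1) ^+ (p j).2)); first by ring.
by rewrite sgn; ring.
Qed.

(** The vertices of each simplex are convex combinations of those of the other, and the product of
    the two coefficient matrices is the identity. Nonnegative entries cannot cancel, so each vertex
    of [P] is a vertex of [Q]. *)
Lemma body_vertices (R : realType) n (P Q : simplex R n) : body P = body Q ->
  exists t : {perm 'I_n.+1}, forall i, P i = Q (t i).
Proof.
move=> PQ.
have vb (S : simplex R n) i : body S (S i).
  exists (fun j => (j == i)%:R); split => [j||]; first by rewrite ler0n.
    by rewrite (bigD1 i) //= eqxx big1 ?addr0 // => j /negPf ->.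
  rewrite (bigD1 i) //= eqxx scale1r big1 ?addr0 // => j /negPf ->.
  by rewrite scale0r.
have HC i : exists c : 'I_n.+1 -> R,
    [/\ forall j, 0 <= c j, \sum_j c j = 1 & P i = \sum_j c j *: Q j].
  by have := vb P i; rewrite PQ.
have HD i : exists c : 'I_n.+1 -> R,
    [/\ forall j, 0 <= c j, \sum_j c j = 1 & Q i = \sum_j c j *: P j].
  by have := vb Q i; rewrite -PQ.
have [c cP] := choice HC; have [d dP] := choice HD.
have V l : \sum_k (k == l)%:R *: P k = P l.
  rewrite (bigD1 l) //= eqxx scale1r big1 ?addr0 // => k /negPf ->.
  by rewrite scale0r.
have cd i k : \sum_j c i j * d j k = (k == i)%:R.
  have [ci0 ci1 ciE] := cP i.
  apply: (@barycentric_uniq R n P (fun k => \sum_j c i j * d j k) (fun k => (k == i)%:R)).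
    rewrite exchange_big /= (eq_bigr (c i)) => [|j _].
      by rewrite ci1 (bigD1 i) //= eqxx big1 ?addr0 // => j /negPf ->.
    by rewrite -mulr_sumr; have [_ -> _] := dP j; rewrite mulr1.
  rewrite [RHS]V [RHS]ciE; under eq_bigr do rewrite scaler_suml.
  rewrite exchange_big /=; apply: eq_bigr => j _.
  have [_ _ ->] := dP j; rewrite scaler_sumr.
  by apply: eq_bigr => l _; rewrite scalerA.
have HT i : exists j, P i = Q j.
  have [ci0 ci1 ciE] := cP i.
  have [j cj] : exists j, c i j != 0.
    apply: contrapT => H; have := ci1; rewrite big1 => [/esym/eqP|j _].
      by rewrite oner_eq0.
    by apply: contrapT => /eqP Hj; apply: H; exists j.
  exists j; have [dj0 dj1 ->] := dP j.
  have dk k : k != i -> d j k = 0.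
    move=> ki; have := cd i k; rewrite (negPf ki) => E.
    have := psumr_eq0P _ E => /(_ _ j isT) H.
    have /eqP : c i j * d j k = 0.
      by apply: H => l _; rewrite mulr_ge0 //; have [] := dP l.
    by rewrite mulf_eq0 (negPf cj) => /eqP.
  have di : d j i = 1.
    by rewrite -dj1 (bigD1 i) //= big1 ?addr0 // => k ki; rewrite dk.
  rewrite (bigD1 i) //= di scale1r big1 ?addr0 // => k ki.
  by rewrite dk // scale0r.
have [t tE] := choice HT.
have tinj : injective t.
  move=> i j ij; have E : P i = P j by rewrite !tE ij.
  have := @barycentric_uniq R n P (fun k => (k == i)%:R) (fun k => (k == j)%:R).
  have S (l : 'I_n.+1) : \sum_k (k == l)%:R = 1 :> R.
    by rewrite (bigD1 l) //= eqxx big1 ?addr0 // => k /negPf ->.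
  rewrite !S !V => /(_ erefl E i); rewrite eqxx => /esym/eqP.
  by rewrite pnatr_eq1 eqb1 => /eqP.
by exists (perm tinj) => i; rewrite permE.
Qed.

(** Similar families are compared through bodies, which forget the labelling that [outward_normal]
    refers to. *)
Lemma body_facet_normals (R : realType) n (P Q : simplex R n) : (0 < n)%N ->
  body P = body Q -> facet_normals P = facet_normals Q.
Proof.
move=> n0 /body_vertices [t tE].
have N i : outward_normal P i = outward_normal Q (t i).
  have [f1 fE fi] := outward_normalP Q (t i) n0.
  apply: is_outward_normal_uniq => //; split => //.
    by move=> j k ji ki; rewrite !tE; apply: fE; rewrite (inj_eq perm_inj).
  by move=> j ji; rewrite !tE; apply: fi; rewrite (inj_eq perm_inj).
apply/seteqP; split => u [i uE].
  by exists (t i); rewrite -N.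
by exists ((t^-1)%g i); rewrite N permKV.
Qed.

(** * Orthogonal images of simplices and similarity of families *)

Lemma dot_mulmx (R : realType) n (x y : 'rV[R]_n) : dot x y = (x *m y^T) 0 0.
Proof. by rewrite mxE; apply: eq_bigr => i _; rewrite mxE. Qed.

Lemma dot_orthogonal (R : realType) n (M : 'M[R]_n) (x y : 'rV[R]_n) :
  M *m M^T = 1%:M -> dot (x *m M) (y *m M) = dot x y.
Proof. by move=> MM; rewrite !dot_mulmx trmx_mul mulmxA -(mulmxA x) MM mulmx1. Qed.

Section Isometry.
Variables (R : realType) (n : nat) (M : 'M[R]_n).
Hypothesis n0 : (0 < n)%N.
Hypothesis MM : M *m M^T = 1%:M.

Lemma image_indep (P : simplex R n) :
  affinely_independent (fun i => P i *m M).
Proof.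
move=> c c0 cM; apply: (@vertex_indep _ _ P c c0).
have : (\sum_i c i *: (P i *m M)) *m M^T = 0 by rewrite cM mul0mx.
rewrite mulmx_suml => E; rewrite -[RHS]E; apply: eq_bigr => i _.
by rewrite -scalemxAl -mulmxA MM mulmx1.
Qed.

Definition image_simplex P : simplex R n := Simplex (@image_indep P).

Lemma image_normal P i : outward_normal (image_simplex P) i = outward_normal P i *m M.
Proof.
have [/enorm1P f1 fE fi] := outward_normalP P i n0.
apply: is_outward_normal_uniq => //; split => [|j k ji ki|j ji].
- by apply/enorm1P; rewrite dot_orthogonal.
- by rewrite !dot_orthogonal //; exact: fE.
- by rewrite !dot_orthogonal //; exact: fi.
Qed.

Lemma image_facet_normals P :
  facet_normals (image_simplex P) = (fun u => u *m M) @` facet_normals P.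
Proof.
apply/seteqP; split => u.
  move=> [i]; rewrite image_normal => -[->|->].
    by exists (outward_normal P i) => //; exists i; left.
  exists (- outward_normal P i); last by rewrite mulNmx.
  by exists i; right.
move=> [w [i [->|->]] <-]; exists i; rewrite image_normal; [by left|right].
by rewrite mulNmx.
Qed.

Lemma image_body P : body (image_simplex P) = (fun u => u *m M) @` body P.
Proof.
have E c : (\sum_i c i *: P i) *m M = \sum_i c i *: (P i *m M).
  by rewrite mulmx_suml; apply: eq_bigr => i _; rewrite -scalemxAl.
apply/seteqP; split => y.
  by move=> [c [c0 c1 ->]]; exists (\sum_i c i *: P i); [exists c|rewrite E].
by move=> [_ [c [c0 c1 ->]] <-]; exists c; split => //; rewrite E.
Qed.

End Isometry.

(** With the two frames as rows of orthogonal matrices, the map is the inverse of the first followed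
    by the second. *)
Lemma frame_isometry (R : realType) n (e e' : nat -> 'rV[R]_n) :
  frame e -> frame e' -> exists2 M : 'M[R]_n, M *m M^T = 1%:M &
    forall k, (k <= n.+1)%N -> e k *m M = e' k.
Proof.
move=> fe fe'.
pose A (g : nat -> 'rV[R]_n) : 'M[R]_n := \matrix_(i < n) g i.+1.
have AA g : frame g -> A g *m (A g)^T = 1%:M.
  move=> fg; apply/matrixP => i j; rewrite !mxE -(frame_dot i j fg).
  by apply: eq_bigr => k _; rewrite !mxE.
exists ((A e)^T *m A e').
  rewrite trmx_mul trmxK mulmxA -(mulmxA _ (A e')) AA // mulmx1.
  exact: mulmx1C (AA e fe).
have key (i : 'I_n) : e i.+1 *m ((A e)^T *m A e') = e' i.+1.
  rewrite mulmxA.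
  have -> : e i.+1 *m (A e)^T = delta_mx 0 i.
    apply/rowP => j; rewrite !mxE eqxx -(frame_dot j i fe) dotC.
    by apply: eq_bigr => k _; rewrite !mxE.
  by rewrite -rowE rowK.
move=> [|k] kn; first by rewrite !frame0 // mul0mx.
have [->|kn'] := eqVneq k n; first by rewrite !frameSn // mul0mx.
have kn2 : (k < n)%N by lia.
exact: key (Ordinal kn2).
Qed.

(** A family is determined by the directions of its normals, so the orthogonal map between the two
    frames, a similarity of ratio 1, carries one family onto the other. *)
Lemma coxeter_families_similar (R : realType) n (P P' : simplex R n) :
  (2 <= n)%N -> coxeter_C_tilde P -> coxeter_C_tilde P' ->
  similar_families (Defs.family P) (Defs.family P').
Proof.
move=> n2 cP cP'; have n0 : (0 < n)%N by lia.
have [s [e [v [r [fe _ N _]]]]] := adapted_frame_exists n2 cP.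
have [s' [e' [v' [r' [fe' _ N' _]]]]] := adapted_frame_exists n2 cP'.
have [M MM Me] := frame_isometry fe fe'.
have MM' : M^T *m M^T^T = 1%:M by rewrite trmxK; exact: mulmx1C.
have FN : (fun u => u *m M) @` facet_normals P = facet_normals P'.
  have K i i' : s i = s' i' -> outward_normal P i *m M = outward_normal P' i'.
    move=> E; rewrite N N' -scalemxAl mulmxBl E.
    have := ltn_ord (s' i') => ?; by rewrite !Me; try lia.
  apply/seteqP; split => u.
    move=> [w [i wE] <-]; exists ((s'^-1)%g (s i)).
    rewrite -(K i) ?permKV //; case: wE => ->; [by left|right].
    by rewrite mulNmx.
  move=> [i']; have E := K ((s^-1)%g (s' i')) i'; rewrite permKV in E.
  rewrite -E // => -[->|->].
    by exists (outward_normal P ((s^-1)%g (s' i'))) => //; eexists; left.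
  exists (- outward_normal P ((s^-1)%g (s' i'))); last by rewrite mulNmx.
  by eexists; right.
exists (fun u => u *m M).
  exists 1 => // y z; rewrite mul1r /enorm -mulmxBl dot_orthogonal //.
apply/seteqP; split => Q.
  rewrite /Defs.family /= => QP'.
  exists (image_simplex MM' Q).
    rewrite /Defs.family /= image_facet_normals // QP' -FN image_comp /=.
    rewrite -[RHS]image_id; apply: eq_imagel => u _ /=.
    by rewrite -mulmxA MM mulmx1.
  rewrite image_body image_comp -[LHS]image_id; apply: eq_imagel => u _ /=.
  by rewrite -mulmxA (mulmx1C MM) mulmx1.
move=> [P1]; rewrite /Defs.family /= => P1P QP1.
rewrite -FN -P1P -(image_facet_normals n0 MM).
by apply: body_facet_normals => //; rewrite image_body.
Qed.

(** * A model of the Coxeter simplex *)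

Definition std_frame (R : realType) n (k : nat) : 'rV[R]_n :=
  \row_(j < n) (j.+1 == k)%:R.

Lemma dot_std_frame (R : realType) n (y : 'rV[R]_n) (i : 'I_n) :
  dot (std_frame R n i.+1) y = y 0 i.
Proof.
rewrite /dot (bigD1 i) //= mxE eqxx mul1r big1 ?addr0 // => j ji.
by rewrite mxE eqSS [(j == i :> nat)](negPf ji) mul0r.
Qed.

Lemma std_frame_out (R : realType) n k : ~~ (0 < k <= n)%N -> std_frame R n k = 0.
Proof.
move=> kn; apply/rowP => j; rewrite !mxE.
by have -> : (j.+1 == k) = false by have := ltn_ord j; lia.
Qed.

Lemma std_frameP (R : realType) n : frame (std_frame R n).
Proof.
move=> i j _ _; have [iP|iN] := boolP (0 < i <= n)%N; last first.
  by rewrite std_frame_out // dot0l andbF.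
have i1 : (i.-1 < n)%N by lia.
have iE : i = (Ordinal i1).+1 by rewrite /=; lia.
by rewrite iE dot_std_frame mxE -iE andbT.
Qed.

(** Vertex [k] has [k] coordinates 0 followed by coordinates 1: these are the vertices of the closed
    alcove 0 <= x_1 <= ... <= x_n <= 1. Coordinatewise, a relation says that the partial sums of [c]
    vanish. *)
Lemma chain_vertices_indep (R : realType) n :
  affinely_independent (fun k : 'I_n.+1 => \row_(j < n) ((k <= j)%N%:R : R)).
Proof.
move=> c c0 cV.
have S (j : nat) : (j <= n)%N -> \sum_(k < n.+1 | (k <= j)%N) c k = 0.
  rewrite leq_eqVlt => /predU1P[->|jn].
    rewrite -[RHS]c0; apply: eq_bigl => k; exact: leq_ord.
  have := congr1 (fun A : 'rV[R]_n => A 0 (Ordinal jn)) cV.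
  rewrite summxE [X in _ = X]mxE => E; rewrite -[RHS]E big_mkcond /=.
  by apply: eq_bigr => k _; rewrite !mxE /=; case: leqP; rewrite ?mulr1 ?mulr0.
move=> [k kn]; case: k kn => [|k] kn.
  have := S 0%N isT; rewrite (big_pred1 (Ordinal kn)) // => i.
  by rewrite leqn0.
have := S k.+1 kn; rewrite (bigD1 (Ordinal kn)) //=.
rewrite (eq_bigl (fun i : 'I_n.+1 => (i <= k)%N)); first by rewrite S ?addr0 // ltnW.
by move=> i; rewrite -val_eqE /=; lia.
Qed.

Lemma coxeter_exists (R : realType) n : (2 <= n)%N ->
  exists P : simplex R n, coxeter_C_tilde P.
Proof.
move=> n2; have n0 : (0 < n)%N by lia.
pose P : simplex R n := Simplex (@chain_vertices_indep R n).
exists P; apply: (@adapted_coxeter R n P 1%g (std_frame R n)) => //.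
  exact: std_frameP.
move=> k; rewrite perm1; apply: is_outward_normal_uniq => //.
have L0 := root_len_gt0 R n k; have kn : (k <= n)%N by rewrite -ltnS.
(* The second term corrects the case [i = n.+1], where the frame vector is 0. *)
have D i (m : 'I_n.+1) : (i <= n.+1)%N -> dot (std_frame R n i) (P m) =
    (m < i)%N%:R - (i == n.+1)%:R.
  move=> ilen; have [iP|iN] := boolP (0 < i <= n)%N; last first.
    rewrite std_frame_out // dot0l; have [->|i0] := posnP i; first by rewrite subr0.
    have -> : i = n.+1 by lia.
    by rewrite ltn_ord eqxx subrr.
  have i1 : (i.-1 < n)%N by lia.
  have iE : i = (Ordinal i1).+1 by rewrite /=; lia.
  rewrite {1}iE dot_std_frame mxE /=; have -> : (i == n.+1) = false by lia.
  by rewrite subr0; congr (_%:R); congr nat_of_bool; lia.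
have DR (m : 'I_n.+1) : dot ((root_len R n k)^-1 *: chain_root (std_frame R n) k) (P m) =
    (root_len R n k)^-1 * ((k == n :> nat)%:R - (m == k)%:R).
  rewrite dotZl /chain_root dotBl !D; [|lia|lia]; congr (_ * _).
  have -> : (k == n.+1 :> nat) = false by lia.
  rewrite eqSS ltnS -(val_eqE m k) /=.
  by case: (ltngtP (m : nat) k) => mk /=; ring.
split.
- apply/enorm1P; rewrite dotZl dotZr frame_gram //; last exact: std_frameP.
  by rewrite -root_len_sqr // expr2 mulKf ?mulVf // root_len_neq0.
- by move=> i j /negPf ik /negPf jk; rewrite !DR ik jk.
- move=> j /negPf jk; rewrite !DR jk eqxx ltr_pM2l ?invr_gt0 //.
  by rewrite subr0 ltrBlDr ltrDl.
Qed.

Theorem theorem3 (R : realType) (n : nat) (hn : (2 <= n)%N) :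
  (exists F : set (simplex R n),
     [/\ is_family F,
         forall P, F P -> generates_C_tilde P,
         forall P, F P -> coxeter_C_tilde P
       & forall F' : set (simplex R n), is_family F' ->
           (exists2 P, F' P & generates_C_tilde P) -> similar_families F F'])
  /\ (forall P : simplex R n, generates_C_tilde P <-> coxeter_C_tilde P).
Proof.
have gc (P : simplex R n) : generates_C_tilde P <-> coxeter_C_tilde P.
  by split; [exact: generates_coxeter|exact: coxeter_generates].
split => //; have [P0 cP0] := coxeter_exists R hn.
have FP0 P : Defs.family P0 P -> coxeter_C_tilde P.
  by move=> PP0; exact: family_coxeter hn PP0 cP0.
exists (Defs.family P0); split => //; first by exists P0.
  by move=> P /FP0 /gc.
move=> _ [P' ->] [P PP' /gc cP].
(* The generating member [P] may differ from [P']; having the same normals, it defines the same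
   family. *)
have -> : Defs.family P' = Defs.family P by rewrite /Defs.family PP'.
exact: coxeter_families_similar.
Qed.
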